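(* Let $X\subset\mathbb{R}^n$ be a definable set of pure dimension $d>0$ at the origin $0\in\mathbb{R}^n$. Let $\mathcal{C}=C_0X$ be its tangent cone at $0$, $\mathcal{C}'=C_0((\overline{X})_{sing})$ the tangent cone to $(\overline{X})_{sing}$ at $0$, and $$\mathcal{E}=\{v\in\mathbb{R}^n\setminus\{0\}:\ \ell:=\mathbb{R}_+v\subset\mathcal{C}\setminus\mathcal{C}',\ \#(\mathcal{N}_\ell)>1\}.$$ If $v\in\mathcal{C}\setminus\mathcal{C}'$ is a non zero point such that $C_v\mathcal{C}$ is not a plane (linear subspace) of dimension $d$, then $v\in\mathcal{E}$.
   Context: Fix an arbitrary o-minimal structure expanding the field of real numbers; ''definable'' means definable in it with real parameters. For a definable set $A\subset\mathbb{R}^n$: $\overline{A}$ is its closure; $A_{reg}$ is the set of points of $A$ near which $A$ is a $C^1$ submanifold of $\mathbb{R}^n$, and $A_{sing}=A\setminus A_{reg}$; for $x\in A_{reg}$, $T_xA$ is the tangent space, viewed as a linear subspace of $\mathbb{R}^n$. $\dim A$ is the maximal dimension of a $C^1$ manifold contained in $A$. For $x\in\overline{A}$, $\dim_xA=\min\{\dim(A\cap U): U \text{ an open neighborhood of } x\}$. $A$ is of pure dimension $d$ at $x\in\overline{A}$ if there is an open neighborhood $U$ of $x$ with $\dim_yA=d$ for all $y\in A\cap U$. A ray is an open half-line $\ell=\mathbb{R}_+v=\{rv: r>0\}$, $v\ne0$. The tangent cone of $A$ at $x$ is $C_xA=\{v\in\mathbb{R}^n:\ \text{there are } x^k\in A,\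 t_k\in(0,+\infty) \text{ with } x^k\to x,\ t_k(x^k-x)\to v\}$; in particular $C_v\mathcal{C}$ is the tangent cone at $v$ of the set $\mathcal{C}$. $\mathbb{G}(d,n)$ is the Grassmannian of $d$-dimensional linear subspaces of $\mathbb{R}^n$. For a ray $\ell=\mathbb{R}_+v\subset C_0X$, the Nash fiber $\mathcal{N}_\ell=\mathcal{N}_\ell(X)$ of $X$ at $0$ along $\ell$ is the set of $P\in\mathbb{G}(d,n)$ for which there is a sequence $x^k\in X_{reg}\setminus\{0\}$ with $x^k\to0$, $x^k/\|x^k\|\to v/\|v\|$ and $T_{x^k}X\to P$. *)

(* Defs.v *)
From mathcomp Require Import all_boot all_order all_algebra.
From mathcomp Require Import all_classical all_reals all_analysis.

Set Implicit Arguments.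
Unset Strict Implicit.
Unset Printing Implicit Defensive.

Import Order.TTheory GRing.Theory Num.Theory.
Import numFieldNormedType.Exports.

Local Open Scope classical_set_scope.
Local Open Scope ring_scope.

(* O-minimal structures expanding the real field, presented by their families
   of sets definable with parameters (van den Dries).  All points of R are
   parameters because singletons are finite unions of intervals.  The type
   [interval R] contains bounded and unbounded intervals with open or closed
   ends, in particular the degenerate intervals [a, a]. *)
Record ominimal_structure (R : realType) := OminimalStructure {
  definable : forall n : nat, set (set 'rV[R]_n) ;
  definable0 : forall n, definable (@set0 'rV[R]_n) ;
  definableU : forall n (A B : set 'rV[R]_n),
    definable A -> definable B -> definable (A `|` B) ;
  definableC : forall n (A : set 'rV[R]_n), definable A -> definable (~` A) ;
  definable_cylr : forall n (A : set 'rV[R]_n), definable A ->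
    definable [set x : 'rV[R]_(n + 1) | A (lsubmx x)] ;
  definable_cyll : forall n (A : set 'rV[R]_n), definable A ->
    definable [set x : 'rV[R]_(1 + n) | A (rsubmx x)] ;
  definable_diag : forall n (i j : 'I_n),
    definable [set x : 'rV[R]_n | x ord0 i = x ord0 j] ;
  definable_proj : forall n (A : set 'rV[R]_(n + 1)), definable A ->
    definable [set lsubmx x | x in A] ;
  definable_lt : definable [set x : 'rV[R]_2 | x ord0 0 < x ord0 1] ;
  definable_add : definable [set x : 'rV[R]_3 |
    x ord0 0 + x ord0 1 = x ord0 (inord 2)] ;
  definable_mul : definable [set x : 'rV[R]_3 |
    x ord0 0 * x ord0 1 = x ord0 (inord 2)] ;
  ominimality : forall A : set 'rV[R]_1, definable A <->
    exists s : seq (interval R),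
      A = [set x | exists2 i, i \in s & x ord0 ord0 \in i] }.

Section Geometry.
Context {R : realType}.

(* For finite-dimensional [V], continuity of the differential can be tested
   on each fixed vector. *)
Definition C1_on (V W : normedModType R) (U : set V) (f : V -> W) : Prop :=
  forall x, U x ->
    differentiable f x /\ forall h, {for x, continuous (fun y => 'd f y h)}.

Section Submanifolds.
Context {n : nat}.
Implicit Types (A M U V : set 'rV[R]_n) (x v : 'rV[R]_n).

(* [phi], with inverse [psi], is a C^1 diffeomorphism from an open
   neighborhood [U] of [x] onto an open set [V] which maps [M `&` U] onto
   [(R^k x {0}) `&` V]. *)
Definition has_C1_chart (k : nat) M x : Prop :=
  (k <= n)%N /\
  exists U V (phi psi : 'rV[R]_n -> 'rV[R]_n),
  [/\ open U /\ open V, U x, C1_on U phi /\ C1_on V psi,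
      (forall y, U y -> V (phi y) /\ psi (phi y) = y) /\
      (forall z, V z -> U (psi z) /\ phi (psi z) = z)
    & forall y, U y ->
      (M y <-> forall i : 'I_n, (k <= i)%N -> phi y ord0 i = 0)].

Definition C1_submanifold (k : nat) M : Prop :=
  forall x, M x -> has_C1_chart k M x.

Definition reg A : set 'rV[R]_n :=
  [set x | A x /\ exists U k,
    [/\ open U, U x & C1_submanifold k (A `&` U)]].

Definition sing A : set 'rV[R]_n := A `\` reg A.

(* Velocities at [x] of C^1 curves in [A]. *)
Definition velocities A x : set 'rV[R]_n :=
  [set v | exists (e : R) (c : R -> 'rV[R]_n),
    [/\ 0 < e, C1_on `](- e), e[ c, forall t, t \in `](- e), e[ -> A (c t),
        c 0 = x & c^`()%classic 0 = v]].

(* [T_x A], meaningful when [x] is in [reg A]: there the velocities form a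
   linear subspace; otherwise the value may be the default 0. *)
Definition tangent_space A x : {vspace 'rV[R]_n} :=
  xget 0%VS [set T : {vspace 'rV[R]_n} | [set` T] = velocities A x].

(* The value is 0 when [A] is empty. *)
Definition set_dim A : nat :=
  \max_(k < n.+1 |
    `[< exists M, [/\ M !=set0, C1_submanifold k M & M `<=` A] >]) k.

(* [is_dim_at A x d] is dim_x A = d. *)
Definition is_dim_at A x (d : nat) : Prop :=
  (exists U, [/\ open U, U x & set_dim (A `&` U) = d]) /\
  (forall U, open U -> U x -> (d <= set_dim (A `&` U))%N).

Definition pure_dim_at A x (d : nat) : Prop :=
  closure A x /\
  exists U, [/\ open U, U x & forall y, (A `&` U) y -> is_dim_at A y d].

Definition tangent_cone A x : set 'rV[R]_n :=
  [set v | exists (u : nat -> 'rV[R]_n) (t : nat -> R),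
    [/\ forall k, A (u k), forall k, 0 < t k, u @ \oo --> x
      & (fun k => t k *: (u k - x)) @ \oo --> v]].

Definition ray v : set 'rV[R]_n := [set r *: v | r in [set r : R | 0 < r]].

(* The Euclidean norm; the library norm [`|v|] on ['rV[R]_n] is the sup norm. *)
Definition enorm v : R := Num.sqrt (\sum_i v ord0 i ^+ 2).

Definition normalize v : 'rV[R]_n := (enorm v)^-1 *: v.

(* The matrix, acting on row vectors, of the orthogonal projection onto [P].
   The Grassmannian is topologized by [P |-> orthoproj P]. *)
Definition orthoproj (P : {vspace 'rV[R]_n}) : 'M[R]_n :=
  let B : 'M[R]_(\dim P, n) := \matrix_(i < \dim P) (vbasis P)`_i in
  B^T *m invmx (B *m B^T) *m B.

Definition grassmannian (d : nat) : set {vspace 'rV[R]_n} :=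
  [set P | \dim P = d].

Definition cvg_subspace (T : nat -> {vspace 'rV[R]_n})
    (P : {vspace 'rV[R]_n}) : Prop :=
  (fun k => orthoproj (T k)) @ \oo --> orthoproj P.

(* The Nash fiber of [X] at 0 along the ray through [v]. *)
Definition nash_fiber (d : nat) (X : set 'rV[R]_n) v :
    set {vspace 'rV[R]_n} :=
  [set P | grassmannian d P /\
    exists x : nat -> 'rV[R]_n,
    [/\ forall k, reg X (x k) /\ x k <> 0, x @ \oo --> (0 : 'rV[R]_n),
        (fun k => normalize (x k)) @ \oo --> normalize v
      & cvg_subspace (fun k => tangent_space X (x k)) P]].

(* [(`I_2 #<= N)%card] says that [N] has at least two
   elements. *)
Definition exceptional (d : nat) (X : set 'rV[R]_n) : set 'rV[R]_n :=
  [set v | [/\ v <> 0,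
    ray v `<=` tangent_cone X 0 `\` tangent_cone (sing (closure X)) 0
    & (`I_2 #<= nash_fiber d X v)%card]].

End Submanifolds.
End Geometry.

(* Main.v *)
Require Import Defs.
From HB Require Import structures.
From mathcomp Require Import all_boot all_order all_algebra.
From mathcomp Require Import all_classical all_reals all_analysis.
From mathcomp Require Import ring lra zify.
Import Order.TTheory GRing.Theory Num.Theory.
Import numFieldNormedType.Exports.
Local Open Scope classical_set_scope.
Local Open Scope ring_scope.

Set Implicit Arguments.
Unset Strict Implicit.
Unset Printing Implicit Defensive.

(** Write [Y] for the closure of [X] and [C] for its tangent cone at 0, and
    suppose that the Nash fiber along the ray of [v] has at most one element.
    The claim is that the tangent cone of [C] at [v] is then a plane of dimension
    [d].

    Since [v] is not tangent to the singular part of [Y], near the ray [Y] is a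
    C1 submanifold, and [X] contains an open dense part of it
    ([regular_closure_approx]); its tangent spaces are therefore limits of
    those of [X] at regular points. By compactness of the Grassmannian the
    Nash fiber is reduced to one plane [P] of dimension [d], and the tangent
    spaces of [Y] tend to [P] along the ray ([closure_tangent_near]).

    Hence, near [v], a dilation of [Y] by a large factor is made of sheets which
    are graphs over a ball of [P], of small slope; the radius of the ball does not
    depend on the factor ([sheet], a consequence of the minimisation argument
    [descent]). By compactness such sheets pass through all the points of [C] near
    [v] ([cone_sheet]). The sheet through [v] shows that [P] is contained in
    the tangent cone of [C] at [v] ([plane_in_double_cone]).

    Conversely, a tangent vector of [C] at [v] outside [P] comes from points of
    [C] whose sheets cross the affine space through [v] orthogonal to [P] at
    points other than [v], arbitrarily close to it ([fibre_not_isolated]). The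
    dilations of [Y] meet that space in sets which are discrete and compact,
    hence finite, but whose limit would be infinite and, being definable, would
    contain an interval in one of its coordinates. This is impossible in an
    o-minimal structure ([double_cone_in_plane]).

    Two consequences of o-minimality are used. A definable set which is dense in
    a ball has interior points there ([definable_dichotomy]), and a definable
    family of finite subsets of the line cannot accumulate on an interval
    ([definable_limit_thin]). Both follow from the description of the definable
    subsets of the line together with Baire's theorem. *)

(** * First-order definability *)

Lemma iff_of_eq (P Q : Prop) : P = Q -> P <-> Q.
Proof. by move=> ->. Qed.

Section Definability.
Context {R : realType} (D : ominimal_structure R).
Implicit Types (e : nat -> R) (n m : nat).

Definition row_of n e : 'rV[R]_n := \row_i e i.

(** Formulas with real parameters are shallowly embedded as predicates on the
    assignments [e] of values to the variables, numbered by [nat]. Such a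
    predicate counts as definable when it only looks at the first [n] variables
    and defines a set of the structure; bound variables then need no change of
    ambient space. *)
Definition defpn n (P : (nat -> R) -> Prop) : Prop :=
  exists A : set 'rV[R]_n, definable D A /\ forall e, P e <-> A (row_of n e).

Definition defp (P : (nat -> R) -> Prop) : Prop := exists n, defpn n P.

Lemma defp_ext (P Q : (nat -> R) -> Prop) :
  (forall e, P e <-> Q e) -> defp P -> defp Q.
Proof.
by move=> PQ [n [A [dA PA]]]; exists n, A; split=> // e; rewrite -PQ PA.
Qed.

Lemma defpn_agree n (P : (nat -> R) -> Prop) e e' : defpn n P ->
  (forall i, (i < n)%N -> e i = e' i) -> P e <-> P e'.
Proof.
move=> [A [_ PA]] ee'; rewrite !PA.
suff -> : row_of n e = row_of n e' by [].
by apply/rowP => i; rewrite !mxE ee'.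
Qed.

Lemma defpn_widen n m (P : (nat -> R) -> Prop) :
  (n <= m)%N -> defpn n P -> defpn m P.
Proof.
move=> /subnKC <-; elim: (m - n)%N => [|k IH]; first by rewrite addn0.
move=> /IH [A [dA PA]]; rewrite addnS -addn1.
exists [set x | A (lsubmx x)]; split; first exact: definable_cylr.
move=> e; rewrite PA /=; suff -> : lsubmx (row_of (n + k + 1) e) = row_of (n + k) e by [].
by apply/rowP => i; rewrite !mxE.
Qed.

Lemma definable_defp n (A : set 'rV[R]_n) :
  definable D A -> defpn n (fun e => A (row_of n e)).
Proof. by move=> dA; exists A. Qed.

Lemma defp_definable n (A : set 'rV[R]_n) :
  defpn n (fun e => A (row_of n e)) -> definable D A.
Proof.
move=> [B [dB AB]]; suff -> : A = B by [].
apply/seteqP; split=> x; pose e i := if insub i is Some j then x ord0 j else 0.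
all: have ex : row_of n e = x by apply/rowP => j; rewrite mxE /e valK.
all: by have := AB e; rewrite ex => -[].
Qed.

Lemma defpnC n P : defpn n P -> defpn n (fun e => ~ P e).
Proof.
move=> [A [dA PA]]; exists (~` A); split; first exact: definableC.
by move=> e; rewrite PA.
Qed.

Lemma defpnU n P Q : defpn n P -> defpn n Q -> defpn n (fun e => P e \/ Q e).
Proof.
move=> [A [dA PA]] [B [dB QB]]; exists (A `|` B); split; first exact: definableU.
by move=> e; rewrite PA QB.
Qed.

Lemma defpC P : defp P -> defp (fun e => ~ P e).
Proof. by move=> [n /defpnC]; exists n. Qed.

Lemma defpU P Q : defp P -> defp Q -> defp (fun e => P e \/ Q e).
Proof.
move=> [n nP] [m mQ]; exists (maxn n m).
apply: defpnU; [apply: defpn_widen nP|apply: defpn_widen mQ].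
  exact: leq_maxl.
exact: leq_maxr.
Qed.

Lemma defpI P Q : defp P -> defp Q -> defp (fun e => P e /\ Q e).
Proof.
move=> dP dQ; apply: defp_ext (defpC (defpU (defpC dP) (defpC dQ))) => e.
by split=> [/not_orP[/contrapT ? /contrapT]|[p q] []].
Qed.

Lemma defp_imp (P Q : (nat -> R) -> Prop) : defp P -> defp Q -> defp (fun e => P e -> Q e).
Proof.
move=> dP dQ; apply: defp_ext (defpU (defpC dP) dQ) => e.
by split=> [[]//|pq]; case: (pselect (P e)) => [/pq|]; [right|left].
Qed.

Lemma defpn_shift n P : defpn n P -> defpn n.+1 (fun e => P (fun i => e i.+1)).
Proof.
move=> [A [dA PA]]; exists [set x : 'rV_(1 + n) | A (rsubmx x)].
split; first exact: definable_cyll.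
move=> e; rewrite PA /=.
suff -> : rsubmx (row_of (1 + n) e) = row_of n (fun i => e i.+1) by [].
by apply/rowP => i; rewrite !mxE.
Qed.

Definition upd e k y : nat -> R := fun i => if i == k then y else e i.

Lemma defpn_ex_last n P : defpn n.+1 P ->
  defpn n (fun e => exists y, P (upd e n y)).
Proof.
rewrite -addn1 => -[A [dA PA]]; exists [set lsubmx x | x in A].
split; first exact: definable_proj.
move=> e; split=> [[y /PA Ay]|[x Ax xe]].
  exists (row_of (n + 1) (upd e n y)) => //; apply/rowP => i; rewrite !mxE /= /upd.
  by rewrite ltn_eqF.
exists (x ord0 (rshift n ord0)); apply/PA.
suff -> : row_of (n + 1) (upd e n (x ord0 (rshift n ord0))) = x by [].
apply/rowP => i; rewrite mxE /upd; case: (split_ordP i) => j -> /=.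
  by rewrite ltn_eqF //; move/rowP: xe => /(_ j); rewrite !mxE.
by rewrite ord1 addn0 eqxx.
Qed.

Lemma defpn_eqv n (i j : nat) : (i < n)%N -> (j < n)%N -> defpn n (fun e => e i = e j).
Proof.
move=> ni nj; exists [set x | x ord0 (Ordinal ni) = x ord0 (Ordinal nj)].
split; first exact: definable_diag.
by move=> e /=; rewrite !mxE.
Qed.

Lemma defp_eqv (i j : nat) : defp (fun e => e i = e j).
Proof.
by exists (maxn i j).+1; apply: defpn_eqv; rewrite ltnS ?leq_maxl ?leq_maxr.
Qed.

Lemma defpn_ext n (P Q : (nat -> R) -> Prop) :
  (forall e, P e <-> Q e) -> defpn n P -> defpn n Q.
Proof.
by move=> PQ [A [dA PA]]; exists A; split=> // e; rewrite -PQ PA.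
Qed.

Lemma defpnI n P Q : defpn n P -> defpn n Q -> defpn n (fun e => P e /\ Q e).
Proof.
move=> dP dQ; apply: defpn_ext (defpnC (defpnU (defpnC dP) (defpnC dQ))) => e.
by split=> [/not_orP[/contrapT ? /contrapT]|[p q] []].
Qed.

(** Renaming of variables: fresh variables [N + i] are introduced, forced to
    equal the variables [s i], and projected away from the last one down. *)
Lemma defpn_ren n N (s : nat -> nat) P : defpn n P ->
  (forall i, (i < n)%N -> (s i < N)%N) -> defpn N (fun e => P (fun i => e (s i))).
Proof.
move=> dP sN.
pose Q j e := (forall i, (i < j)%N -> e (N + i)%N = e (s i)) /\
  P (fun i => if (i < j)%N then e (N + i)%N else e (s i)).
have shN k : defpn (k + n) (fun e => P (fun i => e (k + i)%N)).
  elim: k => [|k IH]; first exact: dP.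
  by apply: defpn_ext (defpn_shift IH).
have eqs j : (j <= n)%N ->
    defpn (N + n) (fun e => forall i, (i < j)%N -> e (N + i)%N = e (s i)).
  elim: j => [|j IH] jn.
    by apply: (@defpn_ext _ (fun e => ~ (P (fun i => e (N + i)%N) /\
      ~ P (fun i => e (N + i)%N)))); [split=> // _ []|
      apply/defpnC/defpnI; [|apply/defpnC]; exact: shN].
  apply: defpn_ext (defpnI (IH (ltnW jn)) (@defpn_eqv (N + n) (N + j) (s j) _ _)).
  - move=> e; split=> [[ih eqj] i|h].
      by rewrite ltnS leq_eqVlt => /orP[/eqP ->|/ih].
    by split=> [i ij|]; apply: h; rewrite // ltnS ltnW.
  - by rewrite ltn_add2l.
  - by rewrite ltn_addr // sN.
suff /(_ n (leqnn n)) : forall k, (k <= n)%N -> defpn (N + (n - k)) (Q (n - k)%N).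
  by rewrite subnn addn0; apply: defpn_ext => e; rewrite /Q /=; split=> [[]|].
elim=> [|k IH] kn.
  rewrite subn0; apply: defpn_ext (defpnI (eqs n (leqnn n)) (shN N)) => e; rewrite /Q.
  suff -> : P (fun i => e (N + i)%N) <->
    P (fun i => if (i < n)%N then e (N + i)%N else e (s i)) by [].
  by apply: defpn_agree dP _ => i ->.
have := IH (ltnW kn); move: (subnSK kn) => <-; set j := (n - k.+1)%N.
have jn : (j < n)%N by rewrite /j; lia.
rewrite addnS => /defpn_ex_last; apply: defpn_ext => e.
have updl y i : (i < j)%N -> upd e (N + j) y (N + i) = e (N + i)%N.
  by move=> ij; rewrite /upd eqn_add2l ltn_eqF.
have upds y i : (i < n)%N -> upd e (N + j) y (s i) = e (s i).
  by move=> /sN si; rewrite /upd ltn_eqF // ltn_addr.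
have updj y : upd e (N + j) y (N + j) = y by rewrite /upd eqxx.
rewrite /Q; split=> [[y [eqy Py]]|[eqe Pe]].
  have ye : y = e (s j) by rewrite -[LHS]updj eqy // upds.
  split=> [i ij|].
    by rewrite -(updl y) // eqy ?upds // ?(ltn_trans ij) // ltnS ltnW.
  apply: (iffLR (defpn_agree dP _)) Py => i ni; rewrite ltnS leq_eqVlt.
  case: eqP => [->|_] /=; first by rewrite ltnn updj ye.
  by case: ifP => ij; rewrite ?updl ?upds.
exists (e (s j)); split=> [i|].
  rewrite ltnS leq_eqVlt => /orP[/eqP ->|ij]; first by rewrite updj upds.
  by rewrite updl // upds ?eqe // (ltn_trans ij).
apply: (iffLR (defpn_agree dP _)) Pe => i ni; rewrite [RHS]/= ltnS [(i <= j)%N]leq_eqVlt.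
case: eqP => [->|_] /=; first by rewrite ltnn updj.
by case: ifP => ij; rewrite ?updl ?upds.
Qed.

Lemma defp_ren (s : nat -> nat) P : defp P -> defp (fun e => P (fun i => e (s i))).
Proof.
move=> [n dP]; exists (\max_(i < n) s i).+1.
apply: defpn_ren dP _ => i ni; rewrite ltnS.
exact: (@leq_bigmax _ (fun i : 'I_n => s i) (Ordinal ni)).
Qed.

Definition scons y e : nat -> R := fun i => if i is j.+1 then e j else y.

(** Here and in [defp_all] the quantified variable becomes the variable [0] and
    the others are shifted, so that [apply:] turns a quantified formula into its
    body. *)
Lemma defp_ex (F : R -> (nat -> R) -> Prop) :
  defp (fun e => F (e 0%N) (fun i => e i.+1)) -> defp (fun e => exists y, F y e).
Proof.
set P := fun e => _; move=> [n dP]; exists n.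
pose s i := if i is j.+1 then j else n.
have sn i : (i < n)%N -> (s i < n.+1)%N by case: i => //= i /ltnW; rewrite ltnS => /ltnW.
apply: defpn_ext (defpn_ex_last (defpn_ren dP sn)) => e.
suff Py y : P (fun i => upd e n y (s i)) <-> F y e.
  by split=> -[y /Py]; exists y.
rewrite -[F y e]/(P (scons y e)); apply: defpn_agree dP _ => -[_|i] /=.
  by rewrite /upd eqxx.
by rewrite /upd => /ltnW ni; rewrite ltn_eqF.
Qed.

Lemma defp_all (F : R -> (nat -> R) -> Prop) :
  defp (fun e => F (e 0%N) (fun i => e i.+1)) -> defp (fun e => forall y, F y e).
Proof.
move=> dF; apply: defp_ext (defpC (@defp_ex (fun y e => ~ F y e) (defpC dF))) => e.
by split=> [/forallNP h y|h [y]]; [apply: contrapT|].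
Qed.

Definition deff (f : (nat -> R) -> R) : Prop :=
  defp (fun e => e 0%N = f (fun i => e i.+1)).

Lemma deff_ext (f g : (nat -> R) -> R) : f =1 g -> deff f -> deff g.
Proof. by move=> fg; apply: defp_ext => e; rewrite fg. Qed.

Lemma deff_ren (s : nat -> nat) f : deff f -> deff (fun e => f (fun i => e (s i))).
Proof.
move=> df; exact: defp_ren (fun i => if i is j.+1 then (s j).+1 else 0%N) _ df.
Qed.

Lemma defp_subst (F : R -> (nat -> R) -> Prop) f : deff f ->
  defp (fun e => F (e 0%N) (fun i => e i.+1)) -> defp (fun e => F (f e) e).
Proof.
move=> df dF; apply: (@defp_ext (fun e => exists y, y = f e /\ F y e)).
  by move=> e; split=> [[y [-> //]]|]; exists (f e).
by apply: defp_ex; apply: defpI.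
Qed.

Lemma deff_var i : deff (fun e => e i).
Proof. exact: defp_eqv. Qed.

Lemma defp_itv (i : interval R) : defp (fun e => e 0%N \in i).
Proof.
exists 1%N, [set x | x ord0 ord0 \in i]; split; last by move=> e /=; rewrite mxE.
by apply/ominimality; exists [:: i]; apply/seteqP; split=> x /=;
  [exists i; rewrite ?mem_head|case=> j; rewrite inE => /eqP ->].
Qed.

Lemma deff_cst c : deff (fun=> c).
Proof.
apply: defp_ext (defp_itv `[c, c]) => e; rewrite itvxx inE.
by split=> /eqP.
Qed.

Lemma defp_lt f g : deff f -> deff g -> defp (fun e => f e < g e).
Proof.
move=> df dg; apply: (@defp_subst (fun y e => y < g e)) => //.
apply: (@defp_subst (fun y e => e 0%N < y)); first exact: deff_ren succn _ dg.
have : defp (fun e => e 0%N < e 1%N).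
  have := definable_defp (definable_lt D) => d; exists 2; apply: defpn_ext d => e.
  by rewrite /= !mxE.
exact: (defp_ren (fun i => if i is 0 then 1 else if i is 1 then 0 else i)%N).
Qed.

Lemma defp_eq f g : deff f -> deff g -> defp (fun e => f e = g e).
Proof. by move=> df dg; apply: (@defp_subst (fun y e => y = g e)). Qed.

Lemma defp_le f g : deff f -> deff g -> defp (fun e => f e <= g e).
Proof.
move=> df dg; apply: defp_ext (defpC (defp_lt dg df)) => e.
by rewrite leNgt; split=> [/negP|/negP].
Qed.

Lemma deffD f g : deff f -> deff g -> deff (fun e => f e + g e).
Proof.
move=> df dg; rewrite /deff.
apply: (@defp_subst (fun y e => e 0%N = y + g (fun i => e i.+1))).
  exact: (deff_ren succn df).
apply: (@defp_subst (fun y e => e 1%N = e 0%N + y)).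
  exact: (deff_ren (fun i => i.+2) dg).
have : defp (fun e => e 0%N + e 1%N = e 2%N).
  have := definable_defp (definable_add D) => d; exists 3; apply: defpn_ext d => e.
  by rewrite /= !mxE /= inordK.
move=> /(defp_ren (fun i => if i is 0 then 1 else if i is 1 then 0 else i)%N).
by apply: defp_ext => e.
Qed.

Lemma deffM f g : deff f -> deff g -> deff (fun e => f e * g e).
Proof.
move=> df dg; rewrite /deff.
apply: (@defp_subst (fun y e => e 0%N = y * g (fun i => e i.+1))).
  exact: (deff_ren succn df).
apply: (@defp_subst (fun y e => e 1%N = e 0%N * y)).
  exact: (deff_ren (fun i => i.+2) dg).
have : defp (fun e => e 0%N * e 1%N = e 2%N).
  have := definable_defp (definable_mul D) => d; exists 3; apply: defpn_ext d => e.
  by rewrite /= !mxE /= inordK.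
move=> /(defp_ren (fun i => if i is 0 then 1 else if i is 1 then 0 else i)%N).
by apply: defp_ext => e.
Qed.

Lemma deffN f : deff f -> deff (fun e => - f e).
Proof.
move=> df; apply: deff_ext (deffM (deff_cst (-1)) df) => e.
by rewrite mulN1r.
Qed.

Lemma deffB f g : deff f -> deff g -> deff (fun e => f e - g e).
Proof. by move=> df dg; apply: deffD => //; apply: deffN. Qed.

Lemma deff_sum (I : Type) (s : seq I) (f : I -> (nat -> R) -> R) :
  (forall i, deff (f i)) -> deff (fun e => \sum_(i <- s) f i e).
Proof.
move=> df; elim: s => [|i s IH].
  by apply: deff_ext (deff_cst 0) => e; rewrite big_nil.
by apply: deff_ext (deffD (df i) IH) => e; rewrite big_cons.
Qed.

Lemma defp_true : defp (fun=> True).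
Proof. by apply: defp_ext (defp_eqv 0 0) => e; split. Qed.

Lemma defp_all_ord n (P : 'I_n -> (nat -> R) -> Prop) :
  (forall i, defp (P i)) -> defp (fun e => forall i, P i e).
Proof.
move=> dP; suff dPs (s : seq 'I_n) : defp (fun e => forall i, i \in s -> P i e).
  by apply: defp_ext (dPs (enum 'I_n)) => e; split=> h i; [apply: h; rewrite mem_enum|].
elim: s => [|i s IH]; first by apply: defp_ext defp_true => e; split.
apply: defp_ext (defpI (dP i) IH) => e; split=> [[Pi ih] j|h].
  by rewrite inE => /orP[/eqP ->|/ih].
by split=> [|j js]; apply: h; rewrite inE ?eqxx ?js ?orbT.
Qed.

Definition defv n (g : (nat -> R) -> 'rV[R]_n) : Prop :=
  forall i, deff (fun e => g e ord0 i).

Lemma defp_exv n (F : 'rV[R]_n -> (nat -> R) -> Prop) :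
  defp (fun e => F (row_of n e) (fun i => e (n + i)%N)) ->
  defp (fun e => exists x, F x e).
Proof.
elim: n F => [|n IH] F dF.
  apply: defp_ext dF => e; split=> [h|[x]]; first by exists (row_of 0 e).
  by rewrite (_ : x = row_of 0 e) //; apply/rowP => -[].
apply: (@defp_ext (fun e => exists y, exists x : 'rV_n,
    F (row_mx (\row_(i < 1) y) x : 'rV_(1 + n)) e)).
  move=> e; split=> [[y [x]]|[x]]; first by exists (row_mx (\row_(i < 1) y) x).
  exists (x ord0 ord0), (@rsubmx _ _ 1 n x).
  rewrite (_ : (\row_(i < 1) x ord0 ord0) = @lsubmx _ _ 1 n x) ?hsubmxK //.
  by apply/rowP => i; rewrite !mxE (ord1 i); congr (x _ _); apply/val_inj.
apply: defp_ex.
pose G (x : 'rV_n) e := F (row_mx (\row_(i < 1) e 0%N) x : 'rV_(1 + n)) (fun i => e i.+1).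
apply: (IH G); rewrite /G.
pose s i := if i is 0 then n else if (i < n.+1)%N then i.-1 else i.
apply: defp_ext (defp_ren s dF) => e; apply: iff_of_eq.
congr (F _ _).
  apply/rowP => i; rewrite [LHS]mxE; case: (split_ordP (i : 'I_(1 + n))) => j ->.
    by apply: etrans (esym (row_mxEl _ _ _ _)); rewrite mxE ord1 /= addn0.
  by apply: etrans (esym (row_mxEr _ _ _ _)); rewrite mxE /= ltnS ltn_ord.
by apply/funext => i; rewrite /s /= addSn ltnS ltnNge leq_addr /= addnS.
Qed.

Lemma defv_var n k : defv (fun e => row_of n (fun i => e (k + i)%N)).
Proof. by move=> i; apply: deff_ext (deff_var (k + i)) => e; rewrite mxE. Qed.

Lemma defv_cst n (x : 'rV[R]_n) : defv (fun=> x).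
Proof. by move=> i; apply: deff_cst. Qed.

Lemma defv_ren n (s : nat -> nat) (g : (nat -> R) -> 'rV[R]_n) :
  defv g -> defv (fun e => g (fun i => e (s i))).
Proof. by move=> dg i; exact: (deff_ren s (dg i)). Qed.

Lemma defvB n (g h : (nat -> R) -> 'rV[R]_n) :
  defv g -> defv h -> defv (fun e => g e - h e).
Proof. by move=> dg dh i; apply: deff_ext (deffB (dg i) (dh i)) => e; rewrite !mxE. Qed.

Lemma defvZ n f (g : (nat -> R) -> 'rV[R]_n) :
  deff f -> defv g -> defv (fun e => f e *: g e).
Proof. by move=> df dg i; apply: deff_ext (deffM df (dg i)) => e; rewrite !mxE. Qed.

Lemma defv_mulmx n m (g : (nat -> R) -> 'rV[R]_n) (M : 'M[R]_(n, m)) :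
  defv g -> defv (fun e => g e *m M).
Proof.
move=> dg i; apply: deff_ext (deff_sum (index_enum 'I_n) (f := fun j e => g e ord0 j * M j i) _).
  by move=> e; rewrite mxE.
by move=> j; apply: deffM (dg j) (deff_cst _).
Qed.

Lemma defp_eqvec n (g h : (nat -> R) -> 'rV[R]_n) :
  defv g -> defv h -> defp (fun e => g e = h e).
Proof.
move=> dg dh; have := defp_all_ord (fun i => defp_eq (dg i) (dh i)); apply: defp_ext => e.
by split=> [gh|->]//; apply/rowP.
Qed.

Lemma defp_mem n (A : set 'rV[R]_n) g : definable D A -> defv g -> defp (fun e => A (g e)).
Proof.
move=> dA dg; apply: (@defp_ext (fun e => exists x, x = g e /\ A x)).
  by move=> e; split=> [[x [-> //]]|]; exists (g e).
apply: defp_exv; apply: defpI; last by exists n; exact: definable_defp.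
apply: defp_eqvec; first exact: (@defv_var n 0).
exact: (defv_ren (fun i => n + i)%N dg).
Qed.

Lemma norm_rV_lt n (x : 'rV[R]_n) (c : R) :
  `|x| < c <-> 0 < c /\ forall i, - c < x ord0 i /\ x ord0 i < c.
Proof.
rewrite -[`|x|]/(mx_norm x) mx_normrE; split=> [/bigmax_ltP[c0 h]|[c0 h]].
  by split=> // i; have := h (ord0, i) isT; rewrite /= ltr_norml => /andP.
apply/bigmax_ltP; split=> // -[i j] _ /=; rewrite ord1 ltr_norml.
by apply/andP; exact: h.
Qed.

Lemma norm_rV_le n (x : 'rV[R]_n) (c : R) :
  `|x| <= c <-> 0 <= c /\ forall i, - c <= x ord0 i /\ x ord0 i <= c.
Proof.
rewrite -[`|x|]/(mx_norm x) mx_normrE; split=> [/bigmax_leP[c0 h]|[c0 h]].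
  by split=> // i; have := h (ord0, i) isT; rewrite /= ler_norml => /andP.
apply/bigmax_leP; split=> // -[i j] _ /=; rewrite ord1 ler_norml.
by apply/andP; exact: h.
Qed.

Lemma defp_norm_lt n (g : (nat -> R) -> 'rV[R]_n) f :
  defv g -> deff f -> defp (fun e => `|g e| < f e).
Proof.
move=> dg df; apply: (@defp_ext (fun e => 0 < f e /\
    forall i, - f e < g e ord0 i /\ g e ord0 i < f e)).
  by move=> e; rewrite norm_rV_lt.
apply: defpI; first exact: defp_lt (deff_cst 0) df.
apply: defp_all_ord => i; apply: defpI; apply: defp_lt => //; exact: deffN.
Qed.

Lemma defp_norm_le n (g : (nat -> R) -> 'rV[R]_n) f :
  defv g -> deff f -> defp (fun e => `|g e| <= f e).
Proof.
move=> dg df; apply: (@defp_ext (fun e => 0 <= f e /\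
    forall i, - f e <= g e ord0 i /\ g e ord0 i <= f e)).
  by move=> e; rewrite norm_rV_le.
apply: defpI; first exact: defp_le (deff_cst 0) df.
apply: defp_all_ord => i; apply: defpI; apply: defp_le => //; exact: deffN.
Qed.

(** The variables that the formula may have beyond the first [n] are eliminated
    by equating them with the variable [0]. *)
Lemma defp_set n (A : set 'rV[R]_n) :
  defp (fun e => A (row_of n e)) -> definable D A.
Proof.
move=> [m dA]; apply: defp_definable.
pose s i := if (i < n)%N then i else 0%N.
case: n A dA @s => [|n] A dA s.
  have [A0|A0] := pselect (A 0).
    have AT : forall x, A x by move=> x; rewrite (_ : x = 0) //; apply/rowP => -[].
    exists (~` set0); split; first exact/definableC/definable0.
    by move=> e; split=> _; [case|exact: AT].
  exists set0; split; first exact/definable0.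
  by move=> e; split=> //; rewrite (_ : row_of 0 e = 0) //; apply/rowP => -[].
have sn i : (i < m)%N -> (s i < n.+1)%N by rewrite /s; case: ifP.
apply: defpn_ext (defpn_ren dA sn) => e; apply: iff_of_eq; congr (A _).
by apply/rowP => i; rewrite !mxE /s ltn_ord.
Qed.

End Definability.

(** * Consequences of o-minimality *)

(** Matrix spaces are complete and normed; Baire's theorem wants both at once. *)
HB.instance Definition _ (R : realType) (m n : nat) :=
  Complete.copy 'M[R]_(m, n) 'M[R]_(m, n).

Section Ominimality.
Context {R : realType} (D : ominimal_structure R).

Lemma defp_row1 (S : R -> Prop) : defp D (fun e => S (e 0%N)) ->
  definable D [set x : 'rV[R]_1 | S (x ord0 ord0)].
Proof. by move=> dS; apply: defp_set; apply: defp_ext dS => e; rewrite /= mxE. Qed.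

(** A finite union of intervals does not oscillate at [p]. *)
Lemma definable_right (S : R -> Prop) p : defp D (fun e => S (e 0%N)) ->
  exists2 h, 0 < h & (forall x, p < x < p + h -> S x) \/
                     (forall x, p < x < p + h -> ~ S x).
Proof.
move=> /defp_row1/ominimality[s sS].
have {}sS x : S x <-> exists2 i, i \in s & x \in i.
  have := congr1 (fun A : set 'rV[R]_1 => A (\row_i x)) sS.
  by rewrite /= !mxE => ->.
suff [h h0 [hs|hs]] : exists2 h, 0 < h &
    (forall x, p < x < p + h -> exists2 i, i \in s & x \in i) \/
    (forall x, p < x < p + h -> ~ exists2 i, i \in s & x \in i).
- by exists h => //; left => x /hs /sS.
- by exists h => //; right => x /hs h1 /sS.
elim: s {sS} => [|i s [h h0 [IH|IH]]].
- by exists 1 => //; right => x _ [].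
- exists h => //; left => x /IH [j js xj]; exists j => //.
  by rewrite inE js orbT.
(* An interval meeting every right neighbourhood of [p] contains one. *)
have [[x0 /andP[px0 _] x0i]|noi] :=
  pselect (exists2 x0, p < x0 < p + h & x0 \in i); last first.
  exists h => //; right => x xph [j]; rewrite inE => /orP[/eqP -> xi|js xj].
    by apply: noi; exists x.
  by apply: (IH x xph); exists j.
have [near_p|] := pselect (forall h', 0 < h' -> exists2 x, p < x < p + h' & x \in i).
  exists (x0 - p); first by rewrite subr_gt0.
  left => x /andP[px]; rewrite addrC subrK => xx0; exists i; first exact: mem_head.
  have [|y /andP[py]] := near_p (x - p); first by rewrite subr_gt0.
  rewrite addrC subrK => yx yi.
  apply: (@interval_is_interval _ i y x0) => //.
  by rewrite (ltW yx) (ltW xx0).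
move=> /existsNP[h'] /not_implyP[h'0 /forall2NP hi].
exists (Num.min h h'); first by rewrite lt_min h0.
right => x /andP[px]; rewrite -ltrBlDl lt_min => /andP[]; rewrite !ltrBlDl => xh xh'.
move=> [j]; rewrite inE => /orP[/eqP -> xi|js xj].
  by have [|] := hi x => //; rewrite px xh'.
by apply: (IH x); [rewrite px xh|exists j].
Qed.

Lemma definable_left (S : R -> Prop) p : defp D (fun e => S (e 0%N)) ->
  exists2 h, 0 < h & (forall x, p - h < x < p -> S x) \/
                     (forall x, p - h < x < p -> ~ S x).
Proof.
move=> dS.
have dN : defp D (fun e => S (- e 0%N)).
  apply: (@defp_subst _ D (fun y _ => S y)) => //.
  exact/deffN/deff_var.
have [h h0 hp] := definable_right (S := fun x => S (- x)) (- p) dN.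
exists h => //; case: hp => hp; [left|right] => x /andP[x1 x2].
  by rewrite -[x]opprK; apply: hp; apply/andP; split; lra.
by rewrite -[x]opprK; apply: hp; apply/andP; split; lra.
Qed.

Lemma definable_accumulation (S : R -> Prop) p : defp D (fun e => S (e 0%N)) ->
  (forall h, 0 < h -> exists x, [/\ x != p, `|x - p| < h & S x]) ->
  exists a b, a < b /\ forall x, a < x < b -> S x.
Proof.
move=> dS acc.
have [h h0 [hS|hS]] := definable_right p dS.
  by exists p, (p + h); split=> //; rewrite ltrDl.
have [k k0 [kS|kS]] := definable_left p dS.
  by exists (p - k), p; split=> //; rewrite gtrBl.
have [|x [xp xhk Sx]] := acc (Num.min h k); first by rewrite lt_min h0.
exfalso; move: xhk; rewrite lt_min !ltr_norml => /andP[/andP[h1 h2] /andP[k1 k2]].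
have [xp1|xp1|xp1] := ltgtP x p; last by rewrite xp1 eqxx in xp.
  by apply: (kS x) => //; apply/andP; split; lra.
by apply: (hS x) => //; apply/andP; split; lra.
Qed.

Lemma ball_not_meagre m (S : nat -> set 'rV[R]_m) (c : 'rV[R]_m) (r : R) : 0 < r ->
  (forall k (a : 'rV[R]_m) (s : R), 0 < s -> (forall x, `|x - a| < s -> `|x - c| < r) ->
    exists b u, 0 < u /\ forall x, `|x - b| < u -> `|x - a| < s /\ ~ S k x) ->
  exists2 x, `|x - c| < r & forall k, ~ S k x.
Proof.
move=> r0 nd; pose F k := ~` closure (ball c r `&` S k).
have inb (a x : 'rV[R]_m) s : ball a s x <-> `|x - a| < s.
  by rewrite -ball_normE /ball_ /= distrC.
have : dense (\bigcap_k F k).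
  apply: Baire => k; split; first by apply: closed_openC; exact: closed_closure.
  move=> U [z Uz] oU; have [[y [Uy cy]]|Uc] := pselect (U `&` closure (ball c r `&` S k) !=set0);
    last by exists z; split=> // cz; apply: Uc; exists z.
  have [y' [[cy' _] Uy']] : ball c r `&` S k `&` U !=set0 by apply: cy; exact: open_nbhs_nbhs.
  have [s s0 sU] : exists2 s, 0 < s & forall x, `|x - y'| < s -> U x /\ `|x - c| < r.
    have : nbhs y' (U `&` ball c r).
      apply: filterI; first exact: open_nbhs_nbhs.
      by apply: open_nbhs_nbhs; split=> //; exact: ball_open.
    move=> /nbhs_ballP[s s0 sU]; exists s => // x xy.
    by have [|Ux /inb] := sU x; first exact/inb.
  have [|b [u [u0 bu]]] := nd k y' s s0; first by move=> x /sU[].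
  exists b; split.
    by have [|/sU[]] := bu b; first by rewrite subrr normr0.
  move=> /(_ (ball b u)) []; first exact: nbhsx_ballx.
  by move=> x [[_ Sx] /inb/bu[_]].
move=> /(_ (ball c r)) []; [by exists c; exact: ballxx|exact: ball_open|].
move=> x [/inb xr Fx]; exists x => // k Skx; apply: (Fx k I).
by apply: subset_closure; split=> //; apply/inb.
Qed.

Lemma countable_cover m (T : countType) (S : T -> set 'rV[R]_m) :
  (forall t (c : 'rV[R]_m) (r : R), 0 < r -> exists a s, 0 < s /\
    (forall x, `|x - a| < s -> `|x - c| < r) /\
    ((forall x, `|x - a| < s -> S t x) \/ (forall x, `|x - a| < s -> ~ S t x))) ->
  forall (c : 'rV[R]_m) (r : R), 0 < r -> (forall x, `|x - c| < r -> exists t, S t x) ->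
  exists t a s, [/\ 0 < s, forall x, `|x - a| < s -> `|x - c| < r &
    forall x, `|x - a| < s -> S t x].
Proof.
move=> dich c r r0 cov; apply: contrapT => no.
have [k a s s0 ac|x xc Sx] := @ball_not_meagre m
  (fun k => if unpickle k is Some t then S t else set0) c r r0.
  case: unpickle => [t|]; last by exists a, s; split=> // x xa; split.
  have [b [u [u0 [bu [Su|Su]]]]] := dich t a s s0.
    by exfalso; apply: no; exists t, b, u; split=> // x /bu/ac.
  by exists b, u; split=> // x xb; split; [exact: bu|exact: Su].
have [t Stx] := cov x xc.
by apply: (Sx (pickle t)); rewrite pickleK.
Qed.

Lemma defp_cst (Q : Prop) : defp D (fun=> Q).
Proof.
have [q|nq] := pselect Q; first by apply: defp_ext (defp_true D) => e; split.
by apply: defp_ext (defpC (defp_true D)) => e; split=> // /(_ I).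
Qed.

Definition snoc m (x : 'rV[R]_m) (y : R) : 'rV[R]_(m + 1) := row_mx x (\row_i y).

Lemma snoc_norm m (x : 'rV[R]_m) y (c : R) : `|snoc x y| < c <-> `|x| < c /\ `|y| < c.
Proof.
rewrite !norm_rV_lt; split=> [[c0 h]|[[c0 hx] hy]].
  split; first by split=> // i; have := h (lshift 1 i); rewrite row_mxEl.
  by have := h (rshift m ord0); rewrite row_mxEr mxE ltr_norml => /andP.
split=> // i; case: (split_ordP i) => j ->; rewrite ?row_mxEl ?row_mxEr //.
by rewrite mxE; move: hy; rewrite ltr_norml => /andP.
Qed.

Lemma snocB m (x x' : 'rV[R]_m) y y' : snoc x y - snoc x' y' = snoc (x - x') (y - y').
Proof.
by rewrite /snoc opp_row_mx add_row_mx; congr row_mx; apply/rowP => i; rewrite !mxE.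
Qed.

Lemma snocK m (z : 'rV[R]_(m + 1)) : snoc (lsubmx z) (z ord0 (rshift m ord0)) = z.
Proof.
rewrite -[RHS]hsubmxK; congr row_mx; apply/rowP => i; rewrite !mxE.
by rewrite (ord1 i).
Qed.

Lemma defv_snoc m (g : (nat -> R) -> 'rV[R]_m) f :
  defv D g -> deff D f -> defv D (fun e => snoc (g e) (f e)).
Proof.
move=> dg df i; case: (split_ordP i) => j ->.
  by apply: deff_ext (dg j) => e; rewrite row_mxEl.
by apply: deff_ext df => e; rewrite row_mxEr mxE.
Qed.

(** Above each point of the base, the set or its complement contains a vertical
    interval with rational end points. By Baire's theorem and induction on the
    dimension, one interval and one of the two cases serve for all the points of
    a small ball. In particular a definable set which is dense in a ball has
    interior points there. *)
Lemma definable_dichotomy m (A : set 'rV[R]_m) (c : 'rV[R]_m) (r : R) :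
  definable D A -> 0 < r -> exists a s, 0 < s /\
    (forall x, `|x - a| < s -> `|x - c| < r) /\
    ((forall x, `|x - a| < s -> A x) \/ (forall x, `|x - a| < s -> ~ A x)).
Proof.
elim: m A c r => [|m IH] A c r dA r0.
  exists c, r; split=> //; split=> //.
  have c_only x : x = c by apply/rowP => -[].
  by have [Ac|Ac] := pselect (A c); [left|right] => x _; rewrite (c_only x).
move: A c dA; rewrite -[m.+1]addn1 => A c dA.
pose ca := lsubmx c; pose cy := c ord0 (rshift m ord0).
pose S (t : bool * (rat * rat)) : set 'rV[R]_m := fun x =>
  let: (b, (p, q)) := t in
  [/\ ratr p < ratr q :> R, cy - r < ratr p :> R /\ ratr q < cy + r :> R &
      forall y, ratr p < y < ratr q -> A (snoc x y) <-> b].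
have dS t : definable D (S t).
  case: t => b [p q]; apply: defp_set.
  apply: (@defp_ext _ _ (fun e =>
    (ratr p < ratr q :> R /\ (cy - r < ratr p :> R /\ ratr q < cy + r :> R)) /\
    forall y, ratr p < y -> y < ratr q ->
      (A (snoc (row_of m e) y) -> b) /\ (b -> A (snoc (row_of m e) y)))).
    move=> e; split=> [[[pq cr] h]|[pq cr h]].
      by split=> // y /andP[py yq]; split; have [] := h y py yq.
    by split=> // y py yq; split=> h'; apply/(h y); rewrite ?py.
  apply: defpI; first exact: defp_cst.
  apply: defp_all; apply: defp_imp; first exact: defp_lt (deff_cst _ _) (deff_var _ _).
  apply: defp_imp; first exact: defp_lt (deff_var _ _) (deff_cst _ _).
  have dm : defp D (fun e => A (snoc (row_of m (fun i => e i.+1)) (e 0%N))).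
    apply: defp_mem => //; apply: defv_snoc (deff_var _ _).
    exact: (@defv_var _ _ m 1).
  by apply: defpI; apply: defp_imp => //; exact: defp_cst.
have [x xc|[b [p q]] [a [s [s0 ac Sa]]]] := countable_cover
    (fun t c r r0 => IH (S t) c r (dS t) r0) (c := ca) r0.
  have dAx : defp D (fun e => A (snoc x (e 0%N))).
    by apply: defp_mem => //; apply: defv_snoc (deff_var _ _); exact: defv_cst.
  have [h h0 hA] := definable_right (S := fun y => A (snoc x y)) cy dAx.
  have [|p] := @rat_in_itvoo R cy (cy + Num.min h r).
    by rewrite ltrDl lt_min h0.
  rewrite in_itv /= => /andP[cp]; rewrite -ltrBlDl lt_min !ltrBlDl => /andP[ph pr].
  have [|q] := @rat_in_itvoo R (ratr p) (cy + Num.min h r).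
    by rewrite -ltrBlDl lt_min !ltrBlDl ph.
  rewrite in_itv /= => /andP[pq]; rewrite -ltrBlDl lt_min !ltrBlDl => /andP[qh qr].
  have crp : cy - r < ratr p by lra.
  case: hA => hA.
    exists (true, (p, q)); split=> // y /andP[py yq]; split=> // _.
    by apply: hA; apply/andP; split; lra.
  exists (false, (p, q)); split=> // y /andP[py yq]; split=> //.
  by move/hA => h1; exfalso; apply: h1; apply/andP; split; lra.
have [|pq [crp cqr] _] := Sa a; first by rewrite subrr normr0.
pose y0 : R := (ratr p + ratr q) / 2.
pose u := Num.min s ((ratr q - ratr p) / 2).
have u0 : 0 < u by rewrite lt_min s0 /=; lra.
exists (snoc a y0), u; split=> //.
have box (z : 'rV_(m + 1)) : `|z - snoc a y0| < u -> `|lsubmx z - a| < s /\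
    ratr p < z ord0 (rshift m ord0) < ratr q.
  rewrite -{1}(snocK z) snocB snoc_norm !lt_min => -[/andP[za _] /andP[_]].
  rewrite ltr_norml /y0 => /andP[z1 z2]; split=> //.
  by apply/andP; split; lra.
split=> [z /box[za /andP[pz zq]]|].
  rewrite -(snocK z) -(snocK c) snocB snoc_norm; split; first exact: ac.
  by rewrite -/cy ltr_norml; apply/andP; split; lra.
case: b Sa => Sa; [left|right] => z /box[/Sa[_ _ h] pzq].
  by rewrite -(snocK z) h.
by rewrite -(snocK z) h.
Qed.

Lemma definable_cover m (T : countType) (S : T -> set 'rV[R]_m) (c : 'rV[R]_m) (r : R) :
  (forall t, definable D (S t)) -> 0 < r ->
  (forall x, `|x - c| < r -> exists t, S t x) ->
  exists t a s, [/\ 0 < s, forall x, `|x - a| < s -> `|x - c| < r &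
    forall x, `|x - a| < s -> S t x].
Proof.
move=> dS; apply: countable_cover => t a s s0.
exact: definable_dichotomy.
Qed.

(** For each [s] the set of the parameters [t] with [T t s] is, close to 0,
    everything or empty, and Baire's theorem makes one of the two alternatives
    uniform on an interval of values of [s]. The first one contradicts the
    thinness of the fibres, the second one the accumulation at [t = 0]. This is a
    planar case of the inequality between the dimension of a definable set and
    that of its frontier. *)
Lemma definable_limit_thin (T : R -> R -> Prop) (r : R) :
  defp D (fun e => T (e 0%N) (e 1%N)) -> 0 < r ->
  (forall t a b, 0 < t < r -> a < b -> exists2 s, a < s < b & ~ T t s) ->
  forall a b, a < b -> exists2 s, a < s < b &
    ~ forall h, 0 < h -> exists t s', [/\ 0 < t < h, `|s' - s| < h & T t s'].
Proof.
move=> dT r0 thin a b ab; apply: contrapT => no.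
have {}no s : a < s < b ->
    forall h, 0 < h -> exists t s', [/\ 0 < t < h, `|s' - s| < h & T t s'].
  by move=> sab; apply: contrapT => h; apply: no; exists s.
pose S (i : bool * nat) : set 'rV[R]_1 := [set x |
  forall t, 0 < t -> t < i.2.+1%:R^-1 -> (T t (x ord0 ord0) -> i.1) /\ (i.1 -> T t (x ord0 ord0))].
have dS i : definable D (S i).
  apply: defp_set; apply: defp_all.
  apply: defp_imp; first exact: defp_lt (deff_cst _ _) (deff_var _ _).
  apply: defp_imp; first exact: defp_lt (deff_var _ _) (deff_cst _ _).
  have d : defp D (fun e => T (e 0%N) (row_of 1 (fun i => e i.+1) ord0 ord0)).
    by apply: defp_ext dT => e; rewrite mxE.
  by apply: defpI; apply: defp_imp => //; exact: defp_cst.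
pose c : 'rV[R]_1 := \row_i ((a + b) / 2).
have nb (x : 'rV[R]_1) (y : 'rV[R]_1) u : `|x - y| < u <-> `|x ord0 ord0 - y ord0 ord0| < u.
  rewrite norm_rV_lt; split=> [[u0 /(_ ord0)]|xy].
    by rewrite !mxE => -[h1 h2]; rewrite ltr_norml h1.
  split; first exact: le_lt_trans xy.
  by move=> i; rewrite (ord1 i) !mxE; apply/andP; rewrite -ltr_norml.
have [|x xc|[i k] [y [u [u0 yc Sy]]]] := definable_cover (S := S) (c := c) (r := (b - a) / 2) dS.
- by lra.
- have dx : defp D (fun e => T (e 0%N) (x ord0 ord0)).
    apply: (@defp_ext _ D (fun e => exists s, s = x ord0 ord0 /\ T (e 0%N) s)).
      by move=> e; split=> [[s [-> //]]|]; exists (x ord0 ord0).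
    apply: defp_ex; apply: defpI; first exact: defp_eq (deff_var _ _) (deff_cst _ _).
    by have := defp_ren (fun i => if i is 0 then 1 else 0)%N dT; apply: defp_ext.
  have [h h0 hT] := definable_right (S := fun t => T t (x ord0 ord0)) 0 dx.
  have [k kh] := ltr_add_invr h0.
  have tk t : 0 < t -> t < k.+1%:R^-1 -> 0 < t < 0 + h.
    by move=> t0 tk; rewrite t0 /=; rewrite !add0r in kh *; exact: lt_trans tk kh.
  by case: hT => hT; [exists (true, k)|exists (false, k)] => t t0 /(tk t t0)/hT.
have yab s : `|s - y ord0 ord0| < u -> a < s < b /\ S (i, k) (\row_i s).
  move=> sy; have sy' : `|\row_i s - y| < u by apply/nb; rewrite mxE.
  split; last exact: Sy.
  have /nb := yc _ sy'; rewrite !mxE ltr_norml => /andP[h1 h2].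
  by apply/andP; split; lra.
pose s0 := y ord0 ord0.
have k0 : 0 < k.+1%:R^-1 :> R by rewrite invr_gt0 ltr0n.
case: i Sy yab => Sy yab.
  have [t [t0 tr tk]] : exists t : R, [/\ 0 < t, t < r & t < k.+1%:R^-1].
    move: k0; set w := k.+1%:R^-1 => k0.
    by have [rw|wr] := leP r w; [exists (r / 2)|exists (w / 2)]; split; lra.
  have [||s /andP[s1 s2] nT] := thin t s0 (s0 + u); [by rewrite t0|by rewrite ltrDl|].
  apply: nT; have [|_ /(_ t t0)] := yab s.
    by rewrite ltr_norml /s0 in s1 s2 *; apply/andP; split; lra.
  by rewrite mxE => h; apply h.
have [|s0ab _] := yab s0; first by rewrite subrr normr0.
have [|t [s [/andP[t0]]]] := no s0 s0ab (Num.min u k.+1%:R^-1); first by rewrite lt_min u0.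
rewrite !lt_min => /andP[_ tk] /andP[su _] Tts.
have [_ /(_ t t0 tk)] := yab s su; rewrite mxE => -[h _].
by have := h Tts.
Qed.

End Ominimality.

(** * Orthogonal projections *)

Section Projections.
Context {R : realType} {n : nat}.
Implicit Types (P : {vspace 'rV[R]_n}) (x : 'rV[R]_n) (N Q : 'M[R]_n).

Lemma mx_entry_le m k (A : 'M[R]_(m, k)) i j : `|A i j| <= `|A|.
Proof.
rewrite -[`|A|]/(mx_norm A) mx_normrE.
exact: (le_bigmax _ (fun ij : 'I_m * 'I_k => `|A ij.1 ij.2|) (i, j)).
Qed.

Lemma rV_norm_le m (x : 'rV[R]_m) (c : R) : 0 <= c ->
  (forall i, `|x ord0 i| <= c) -> `|x| <= c.
Proof. by move=> c0 h; apply/norm_rV_le; split=> // i; apply/andP; rewrite -ler_norml. Qed.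

Lemma mx_norm_le m k (A : 'M[R]_(m, k)) (c : R) : 0 <= c ->
  (forall i j, `|A i j| <= c) -> `|A| <= c.
Proof.
move=> c0 h; rewrite -[`|A|]/(mx_norm A) mx_normrE.
by apply/bigmax_leP; split=> // -[i j] _; exact: h.
Qed.

Lemma norm_mulmx_le p m k (M : 'M[R]_(p, m)) (N : 'M[R]_(m, k)) :
  `|M *m N| <= m%:R * `|N| * `|M|.
Proof.
apply: mx_norm_le => [|i j]; first by rewrite !mulr_ge0.
rewrite mxE (le_trans (ler_norm_sum _ _ _)) //.
apply: (@le_trans _ _ (\sum_(l < m) `|N| * `|M|)).
  apply: ler_sum => l _; rewrite normrM mulrC.
  by apply: ler_pM => //; exact: mx_entry_le.
by rewrite sumr_const card_ord -[leLHS]mulr_natl mulrA.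
Qed.

Lemma gram_unit k (B : 'M[R]_(k, n)) :
  (forall c : 'rV_k, c *m B = 0 -> c = 0) -> B *m B^T \in unitmx.
Proof.
move=> Bfree; rewrite -row_free_unit -kermx_eq0; apply/rowV0P => c /sub_kermxP.
move=> cBB; apply: Bfree.
have : (c *m B) *m (c *m B)^T = 0 by rewrite trmx_mul !mulmxA -(mulmxA c) cBB mul0mx.
move: (c *m B) => y /matrixP/(_ ord0 ord0); rewrite !mxE => /eqP.
rewrite psumr_eq0 => [/allP h|i _]; last by rewrite mxE -expr2 sqr_ge0.
apply/rowP => i; rewrite mxE.
by have := h i; rewrite mem_index_enum mxE -expr2 sqrf_eq0 => /(_ isT)/eqP.
Qed.

Definition basis_mx P : 'M[R]_(\dim P, n) := \matrix_(i < \dim P) (vbasis P)`_i.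

Lemma mulmx_basis_mx P (c : 'rV_(\dim P)) :
  c *m basis_mx P = \sum_i c ord0 i *: (vbasis P)`_i.
Proof.
by rewrite mulmx_sum_row; apply: eq_bigr => i _; rewrite rowK.
Qed.

Lemma basis_mx_free P (c : 'rV_(\dim P)) : c *m basis_mx P = 0 -> c = 0.
Proof.
rewrite mulmx_basis_mx => c0; apply/rowP => i; rewrite mxE.
by have /freeP := basis_free (vbasisP P); apply.
Qed.

Lemma mem_basis_mx P x : x \in P -> exists c, x = c *m basis_mx P.
Proof.
move=> /coord_vbasis xP; exists (\row_i coord (vbasis P) i x).
by rewrite mulmx_basis_mx {1}xP; apply: eq_bigr => i _; rewrite mxE.
Qed.

Lemma orthoprojE P : orthoproj P =
  (basis_mx P)^T *m invmx (basis_mx P *m (basis_mx P)^T) *m basis_mx P.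
Proof. by []. Qed.

Lemma basis_mx_gram P : basis_mx P *m (basis_mx P)^T \in unitmx.
Proof. by apply: gram_unit => c; exact: basis_mx_free. Qed.

Lemma orthoproj_mem P x : x *m orthoproj P \in P.
Proof.
rewrite orthoprojE mulmxA mulmx_basis_mx; apply: rpred_sum => i _.
apply: rpredZ; apply: vbasis_mem; apply: mem_nth.
by rewrite size_tuple.
Qed.

Lemma orthoproj_id P x : x \in P -> x *m orthoproj P = x.
Proof.
move=> /mem_basis_mx[c ->]; rewrite orthoprojE !mulmxA -(mulmxA c).
by rewrite mulmxK // basis_mx_gram.
Qed.

Lemma orthoproj_idem P : orthoproj P *m orthoproj P = orthoproj P.
Proof.
apply/row_matrixP => i; rewrite row_mul; apply: orthoproj_id.
by rewrite rowE; exact: orthoproj_mem.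
Qed.

Lemma orthoproj_sym P : (orthoproj P)^T = orthoproj P.
Proof.
by rewrite orthoprojE !trmx_mul trmxK trmx_inv trmx_mul trmxK mulmxA.
Qed.

Lemma orthoproj_trace P : \tr (orthoproj P) = (\dim P)%:R.
Proof.
by rewrite orthoprojE mxtrace_mulC mulmxA mulmxV ?basis_mx_gram // mxtrace1.
Qed.

Definition fixspace N : {vspace 'rV[R]_n} := lker (linfun (mulmxr (N - 1%:M))).

Lemma mem_fixspace N x : (x \in fixspace N) = (x *m N == x).
Proof. by rewrite memv_ker lfunE /= mulmxBr mulmx1 subr_eq0. Qed.

(** The trace of an idempotent depends on its image only. *)
Lemma fixspace_dim N : N *m N = N -> \tr N = (\dim (fixspace N))%:R.
Proof.
move=> NN; set P := fixspace N; rewrite -orthoproj_trace.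
have -> : orthoproj P = orthoproj P *m N.
  apply/row_matrixP => i; rewrite [RHS]row_mul; apply/esym/eqP.
  by rewrite -mem_fixspace rowE; exact: orthoproj_mem.
rewrite mxtrace_mulC; congr (\tr _).
apply/row_matrixP => i; rewrite [RHS]row_mul orthoproj_id //.
by rewrite mem_fixspace -row_mul NN.
Qed.

Lemma orthoproj_fixspace N : N *m N = N -> N^T = N -> orthoproj (fixspace N) = N.
Proof.
move=> NN NT; set P := fixspace N.
have PN : orthoproj P *m N = orthoproj P.
  apply/row_matrixP => i; rewrite [LHS]row_mul; apply/eqP.
  by rewrite -mem_fixspace rowE; exact: orthoproj_mem.
have NP : N *m orthoproj P = N.
  apply/row_matrixP => i; rewrite [LHS]row_mul orthoproj_id //.
  by rewrite mem_fixspace -row_mul NN.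
by rewrite -[LHS]orthoproj_sym -PN trmx_mul orthoproj_sym NT NP.
Qed.

Lemma orthoproj_norm_le P : `|orthoproj P| <= 1.
Proof.
apply: mx_norm_le => // i j; set Q := orthoproj P.
have QE k l : Q k l = \sum_m Q k m * Q l m.
  rewrite -{1}[Q](orthoproj_idem P) mxE; apply: eq_bigr => m _; congr (_ * _).
  by rewrite -{1}[orthoproj P]orthoproj_sym mxE.
have diag k : 0 <= Q k k <= 1.
  have le l : Q k l ^+ 2 <= Q k k.
    rewrite [leRHS]QE (bigD1 l) //= -expr2 lerDl sumr_ge0 // => m _.
    by rewrite -expr2 sqr_ge0.
  have Qk := le k.
  have q0 := le_trans (sqr_ge0 _) Qk; rewrite q0 /=.
  by rewrite leNgt; apply/negP => q1; nra.
have le : Q i j ^+ 2 <= 1.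
  have /andP[_] := diag i; apply: le_trans.
  rewrite [leRHS]QE (bigD1 j) //= -expr2 lerDl sumr_ge0 // => m _.
  by rewrite -expr2 sqr_ge0.
by rewrite -ler_sqr ?nnegrE // expr1n real_normK // num_real.
Qed.

End Projections.

(** * Differential calculus and tangent vectors *)

Section Calculus.
Context {R : realType}.

Lemma nbhs_dist (V : normedModType R) (x : V) (P : set V) :
  nbhs x P <-> exists2 r : R, 0 < r & forall y, `|y - x| < r -> P y.
Proof.
split=> [/nbhs_ballP[r r0 rP]|[r r0 rP]].
  by exists r => // y yx; apply: rP; rewrite -ball_normE /ball_ /= distrC.
apply/nbhs_ballP; exists r => // y.
by rewrite -ball_normE /ball_ /= distrC => /rP.
Qed.

Lemma open_norm_ball (V : normedModType R) (U : set V) x : open U -> U x ->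
  exists2 r : R, 0 < r & forall y, `|y - x| < r -> U y.
Proof. by move=> oU Ux; apply/nbhs_dist; apply: open_nbhs_nbhs. Qed.

Lemma closure_norm (V : normedModType R) (A : set V) x :
  closure A x <-> forall h : R, 0 < h -> exists2 y, A y & `|y - x| < h.
Proof.
split=> [clx h h0|clx B /nbhs_dist[h h0 hB]].
  have [|y [Ay By]] := clx [set y | `|y - x| < h].
    by apply/nbhs_dist; exists h.
  by exists y.
by have [y Ay yx] := clx h h0; exists y; split=> //; apply: hB.
Qed.

Lemma diff_approx (V W : normedModType R) (f : V -> W) x h : differentiable f x ->
  0 < h -> exists2 r : R, 0 < r &
    forall y, `|y - x| < r -> `|f y - f x - 'd f x (y - x)| <= h * `|y - x|.
Proof.
move=> /diff_locallyP[_ /eqaddoP/(_ h)] + h0 => /(_ h0) /nbhs_dist[r r0 rP].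
exists r => // y yx; have := rP (y - x); rewrite subr0 => /(_ yx).
by rewrite /= !fctE /cst /= subrK opprD addrA.
Qed.

Lemma diff_ext_near (V W : normedModType R) (f g : V -> W) x r h :
  0 < r -> (forall y, `|y - x| < r -> f y = g y) ->
  differentiable f x -> differentiable g x -> 'd f x h = 'd g x h.
Proof.
move=> r0 fg df dg; rewrite -!deriveE //; apply: near_eq_derive.
by apply/nbhs_dist; exists r.
Qed.

Lemma diff_line (V : normedModType R) (a h : V) (s : R) :
  differentiable (fun s : R => a + s *: h) s /\
  forall t, 'd (fun s : R => a + s *: h) s t = t *: h.
Proof.
have D : is_diff s (cst a + ( *:%R ^~ h)) (0 + ( *:%R ^~ h)).
  by apply: is_diffD.
have -> : (fun s : R => a + s *: h) = cst a + ( *:%R ^~ h) by apply/funext.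
split; first by [].
by move=> t; rewrite diff_val -[LHS]/(0 + t *: h) add0r.
Qed.

Lemma diff_along (V W : normedModType R) (f : V -> W) (a h : V) s :
  differentiable f (a + s *: h) ->
  differentiable (fun s : R => f (a + s *: h)) s /\
  forall t, 'd (fun s : R => f (a + s *: h)) s t = t *: 'd f (a + s *: h) h.
Proof.
move=> df; have [dl dlE] := diff_line a h s.
have -> : (fun s : R => f (a + s *: h)) = f \o (fun s => a + s *: h) by [].
split; first exact: differentiable_comp.
by move=> t; rewrite diff_comp //= dlE linearZ.
Qed.

Lemma diff_coord n (V : normedModType R) (f : V -> 'rV[R]_n) x i h : differentiable f x ->
  differentiable (fun y => f y ord0 i) x /\
  'd (fun y => f y ord0 i) x h = 'd f x h ord0 i.
Proof.
move=> df; pose g := fun y : 'rV[R]_n => y ord0 i.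
have glin : linear g by move=> k u v; rewrite /g !mxE.
pose gL := GRing.isLinear.Build R _ _ _ g glin.
pose G : {linear 'rV[R]_n -> R} := HB.pack g gL.
have cG : continuous G by exact: coord_continuous.
have dG y : differentiable G y by exact: linear_differentiable.
split; first exact: (differentiable_comp df (dG _)).
have -> : (fun y => f y ord0 i) = G \o f by [].
by rewrite (diff_comp df (dG _)) [LHS]/= (diff_lin _ cG).
Qed.

(** The mean value inequality, applied to each coordinate along a segment. *)
Lemma mean_value n (V : normedModType R) (f : V -> 'rV[R]_n) (a b : V) (L : V -> 'rV[R]_n) (h : R) :
  0 <= h ->
  (forall s, 0 <= s <= 1 -> differentiable f (a + s *: (b - a)) /\
     `|'d f (a + s *: (b - a)) (b - a) - L (b - a)| <= h) ->
  `|f b - f a - L (b - a)| <= h.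
Proof.
move=> h0 df; apply: rV_norm_le => // i.
pose g (s : R) : R := f (a + s *: (b - a)) ord0 i.
have dg (s : R) : 0 <= s <= 1 -> is_derive s 1 g ('d f (a + s *: (b - a)) (b - a) ord0 i).
  move=> /df[dfs _]; have [dl dlE] := diff_along dfs.
  have [dc dcE] := diff_coord i (1 : R) dl.
  split; first by apply: diff_derivable.
  by rewrite deriveE // dcE dlE scale1r.
have [||s s01 gE] := @MVT R g (fun s => 'd f (a + s *: (b - a)) (b - a) ord0 i) 0 1 ltr01.
- by move=> s; rewrite in_itv /= => /andP[s0 s1]; apply: dg; rewrite !ltW.
- apply: derivable_within_continuous => s; rewrite in_itv /= => s01.
  by have := dg s s01 => -[].
move: gE; rewrite subr0 mulr1 /g scale1r scale0r addr0 [a + _]addrC subrK => gE.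
move: s01; rewrite in_itv /= => /andP[s0 s1].
have [|_] := df s; first by rewrite !ltW.
by move=> /(le_trans (mx_entry_le _ ord0 i)); rewrite !mxE -gE.
Qed.

Lemma C1_diff_near n m (U : set 'rV[R]_n) (f : 'rV[R]_n -> 'rV[R]_m) x h :
  open U -> C1_on U f -> U x -> 0 < h -> exists2 r : R, 0 < r &
    forall y, `|y - x| < r -> U y /\
      forall w, `|'d f y w - 'd f x w| <= h * `|w|.
Proof.
move=> oU C1f Ux h0; have [_ cf] := C1f x Ux.
pose e i : 'rV[R]_n := delta_mx ord0 i.
pose k := h / n.+1%:R.
have k0 : 0 < k by rewrite divr_gt0 // ltr0n.
have ri i : exists r : R, 0 < r /\
    forall y, `|y - x| < r -> `|'d f y (e i) - 'd f x (e i)| <= k.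
  have cfi : (fun y => 'd f y (e i)) @ x --> 'd f x (e i) := cf (e i).
  have /cvgrPdist_le/(_ k k0)/nbhs_dist[r r0 rP] := cfi.
  exists r; split; first exact: r0.
  by move=> y yr; rewrite -normrN opprB; exact: rP y yr.
have [r0 r00 r0U] := open_norm_ball oU Ux.
have [r rP] := choice ri.
pose r1 := \big[Num.min/r0]_i r i.
have rfam y : `|y - x| < r1 -> U y /\ forall i, `|'d f y (e i) - 'd f x (e i)| <= k.
  move=> yr; split; first by apply: r0U; apply: lt_le_trans yr _; exact: bigmin_le_id.
  by move=> i; have [_] := rP i; apply; apply: lt_le_trans yr _; exact: bigmin_le_cond.
exists r1; first by apply: lt_bigmin => // i _; have [] := rP i.
move=> y /rfam[Uy fy]; split; first exact: Uy.
move=> w.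
have wE : w = \sum_i w ord0 i *: e i.
  by rewrite {1}(row_sum_delta w); apply: eq_bigr.
have dE z : 'd f z w = \sum_i w ord0 i *: 'd f z (e i).
  rewrite {1}wE (linear_sum ('d f z)); apply: eq_bigr => i _.
  exact: linearZ.
have dB : 'd f y w - 'd f x w = \sum_i w ord0 i *: ('d f y (e i) - 'd f x (e i)).
  apply: etrans (congr2 (fun a b => a - b) (dE y) (dE x)) _.
  by rewrite -sumrB; apply: eq_bigr => i _; rewrite scalerBr.
apply: (@le_trans _ _ `|\sum_i w ord0 i *: ('d f y (e i) - 'd f x (e i))|).
  by have /eqP := congr1 (fun a => `|a|) dB; rewrite eq_le => /andP[].
apply: le_trans (ler_norm_sum _ _ _) _.
apply: (@le_trans _ _ (\sum_(i < n) `|w| * k)).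
  apply: ler_sum => i _; rewrite normrZ.
  by apply: ler_pM; [exact: normr_ge0|exact: normr_ge0|exact: mx_entry_le|exact: fy].
rewrite sumr_const card_ord -[leLHS]mulr_natl /k.
have -> : n%:R * (`|w| * (h / n.+1%:R)) = n%:R / n.+1%:R * (h * `|w|) by ring.
rewrite -[leRHS]mul1r; apply: ler_wpM2r; first by rewrite mulr_ge0 // ltW.
by rewrite ler_pdivrMr ?ltr0n // mul1r ler_nat.
Qed.

Lemma C1_strict n m (U : set 'rV[R]_n) (f : 'rV[R]_n -> 'rV[R]_m) x h :
  open U -> C1_on U f -> U x -> 0 < h -> exists2 r : R, 0 < r &
    forall y z, `|y - x| < r -> `|z - x| < r ->
      `|f z - f y - 'd f x (z - y)| <= h * `|z - y|.
Proof.
move=> oU C1f Ux h0; have [r r0 rP] := C1_diff_near oU C1f Ux h0.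
exists r => // y z yr zr; apply: mean_value; first by rewrite mulr_ge0 // ltW.
move=> s /andP[s0 s1]; have [|Us fs] := rP (y + s *: (z - y)); last first.
  by split=> //; have [] := C1f _ Us.
have -> : y + s *: (z - y) - x = (1 - s) *: (y - x) + s *: (z - x).
  by apply/rowP => i; rewrite !mxE; ring.
rewrite (le_lt_trans (ler_normD _ _)) // !normrZ !ger0_norm ?subr_ge0 //.
have [->|sn] := eqVneq s 1; first by rewrite subrr mul0r add0r mul1r.
have : (1 - s) * `|y - x| < (1 - s) * r by rewrite ltr_pM2l // subr_gt0 lt_neqAle sn.
have : s * `|z - x| <= s * r by rewrite ler_wpM2l // ltW.
lra.
Qed.

(** The tangent cone again, with errors in place of sequences: see
    [tangent_coneP]. *)
Definition tvec n (A : set 'rV[R]_n) (x w : 'rV[R]_n) : Prop :=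
  forall h, 0 < h -> exists t u, [/\ 0 < t < h, `|u - w| < h & A (x + t *: u)].

Lemma scaler_posK n (t : R) (z : 'rV[R]_n) : 0 < t -> t *: (t^-1 *: z) = z.
Proof. by move=> t0; rewrite scalerA divff ?scale1r // gt_eqF. Qed.

Lemma scaler_posVK n (t : R) (z : 'rV[R]_n) : 0 < t -> t^-1 *: (t *: z) = z.
Proof. by move=> t0; rewrite scalerA mulVf ?scale1r // gt_eqF. Qed.

Lemma invS_cvg0 h : 0 < h -> exists N, forall k, (N <= k)%N -> k.+1%:R^-1 < h :> R.
Proof.
move=> h0; have [N Nh] := ltr_add_invr h0; exists N => k Nk.
rewrite add0r in Nh; apply: le_lt_trans Nh.
by rewrite lef_pV2 ?posrE ?ltr0n // ler_nat ltnS.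
Qed.

Lemma cvg_norm (V : normedModType R) (u : nat -> V) (l : V) :
  u @ \oo --> l <-> forall h : R, 0 < h -> exists N, forall k, (N <= k)%N -> `|u k - l| < h.
Proof.
split=> [/cvgrPdist_lt ul h h0|ul].
  by have [N _ Nh] := ul h h0; exists N => k Nk; rewrite distrC; apply: Nh.
by apply/cvgrPdist_lt => h h0; have [N Nh] := ul h h0; exists N => // k /= /Nh; rewrite distrC.
Qed.

Lemma tangent_coneP n (A : set 'rV[R]_n) x w : tangent_cone A x w <-> tvec A x w.
Proof.
split=> [[u [t [Au t0 /cvg_norm ux /cvg_norm tw]]] h h0|tv].
  have [w0|w0] := eqVneq w 0.
    have hh : 0 < h * (h / 2) by rewrite !mulr_gt0 // divr_gt0.
    have [N /(_ N (leqnn N)) uN] := ux _ hh.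
    exists (h / 2), ((h / 2)^-1 *: (u N - x)); split.
    - by apply/andP; split; lra.
    - have h20 : 0 < h / 2 by rewrite divr_gt0.
      rewrite w0 subr0 normrZ gtr0_norm ?invr_gt0 // mulrC.
      by rewrite ltr_pdivrMr.
    - by rewrite scaler_posK ?divr_gt0 // subrKC.
  have wpos : 0 < `|w| / 2 by rewrite divr_gt0 ?normr_gt0.
  have [N1 h1] := tw _ wpos; have [N2 h2] := tw h h0.
  have [N3 h3] := ux (h * (`|w| / 2)) (mulr_gt0 h0 wpos).
  pose N := maxn N1 (maxn N2 N3).
  have {}h1 := h1 N (leq_maxl _ _).
  have {}h2 := h2 N (leq_trans (leq_maxl _ _) (leq_maxr _ _)).
  have {}h3 := h3 N (leq_trans (leq_maxr _ _) (leq_maxr _ _)).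
  exists (t N)^-1, (t N *: (u N - x)); split=> //; last first.
    by rewrite scaler_posVK // subrKC.
  rewrite invr_gt0 t0 /= -(ltr_pM2l (t0 N)) divff ?gt_eqF //.
  have h4 := ler_normD (w - t N *: (u N - x)) (t N *: (u N - x)).
  rewrite subrK distrC [`|t N *: _|]normrZ gtr0_norm // in h4.
  have : `|w| / 2 < t N * `|u N - x| by lra.
  move=> /lt_le_trans/(_ (ler_wpM2l (ltW (t0 N)) (ltW h3))).
  by rewrite mulrA -{1}[_ / 2]mul1r ltr_pM2r.
have tvk k : {tu : R * 'rV[R]_n | [/\ 0 < tu.1 < k.+1%:R^-1, `|tu.2 - w| < k.+1%:R^-1 &
    A (x + tu.1 *: tu.2)]}.
  apply: cid; have [|t [u h]] := tv k.+1%:R^-1; first by rewrite invr_gt0 ltr0n.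
  by exists (t, u).
pose t k := (sval (tvk k)).1; pose u k := (sval (tvk k)).2.
have tk k : 0 < t k by rewrite /t; case: (tvk k) => tu [] /= /andP[].
have tk' k : t k < k.+1%:R^-1 by rewrite /t; case: (tvk k) => tu [] /= /andP[].
have uk k : `|u k - w| < k.+1%:R^-1 by rewrite /u; case: (tvk k) => tu [].
have xk k : x + t k *: u k - x = t k *: u k by rewrite addrAC subrr add0r.
exists (fun k => x + t k *: u k), (fun k => (t k)^-1); split.
- by move=> k; rewrite /t /u; case: (tvk k) => tu [].
- by move=> k; rewrite invr_gt0.
- apply/cvg_norm => h h0; have M0 : 0 < `|w| + 1 by rewrite ltr_wpDl.
  have [N Nh] := invS_cvg0 (divr_gt0 h0 M0); exists N => k /Nh kh.
  rewrite xk normrZ gtr0_norm //.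
  apply: (@lt_trans _ _ (k.+1%:R^-1 * (`|w| + 1))); last by rewrite -ltr_pdivlMr.
  apply: ltr_pM => //; first exact: ltW.
  have := ler_normD (u k - w) w; rewrite subrK.
  have : k.+1%:R^-1 <= 1 :> R by rewrite invf_le1 ?ler1n ?ltr0n.
  by have := uk k; move: (k.+1%:R^-1) => a; lra.
- apply/cvg_norm => h h0; have [N Nh] := invS_cvg0 h0; exists N => k /Nh; apply: lt_trans.
  by rewrite xk scaler_posVK.
Qed.

Lemma tvec_local n (A B : set 'rV[R]_n) x w r : 0 < r ->
  (forall y, `|y - x| < r -> A y -> B y) -> tvec A x w -> tvec B x w.
Proof.
move=> r0 AB tv h h0; pose M := `|w| + 1.
have M0 : 0 < M by rewrite ltr_wpDl.
pose h' := Num.min (Num.min h 1) (r / M).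
have h'0 : 0 < h' by rewrite !lt_min h0 ltr01 divr_gt0.
have [t [u [/andP[t0]]]] := tv h' h'0.
rewrite !lt_min => /andP[/andP[th t1] tr] /andP[/andP[uh u1] _] Au.
exists t, u; split; rewrite ?t0 ?th //; apply: AB => //.
rewrite addrAC subrr add0r normrZ gtr0_norm //.
apply: (@lt_le_trans _ _ (r / M * M)); last by rewrite divfK // gt_eqF.
apply: ltr_pM => //; first exact: ltW.
by have := ler_normD (u - w) w; rewrite subrK /M; lra.
Qed.

Lemma tvec_sub n (A B : set 'rV[R]_n) x w : A `<=` B -> tvec A x w -> tvec B x w.
Proof. by move=> AB; apply: tvec_local ltr01 _ => y _ /AB. Qed.

Lemma tvec_closure n (A : set 'rV[R]_n) x w : tvec (closure A) x w -> tvec A x w.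
Proof.
move=> tv h h0; have [t [u [/andP[t0 th] uw /closure_norm cl]]] := tv h h0.
have [|y Ay yx] := cl (t * (h - `|u - w|)); first by rewrite mulr_gt0 ?subr_gt0.
exists t, (t^-1 *: (y - x)); split; first by rewrite t0.
  have -> : t^-1 *: (y - x) - w = t^-1 *: (y - (x + t *: u)) + (u - w).
    by apply/rowP => i; rewrite !mxE; field; rewrite gt_eqF.
  rewrite (le_lt_trans (ler_normD _ _)) // -ltrBrDr normrZ gtr0_norm ?invr_gt0 //.
  by rewrite mulrC ltr_pdivrMr // mulrC.
by rewrite scaler_posK // subrKC.
Qed.

Lemma tvecZ n (A : set 'rV[R]_n) x w c : 0 < c -> tvec A x w -> tvec A x (c *: w).
Proof.
move=> c0 tv h h0; pose k := Num.min (h * c) (h / c).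
have [|t [u [/andP[t0]]]] := tv k; first by rewrite lt_min !mulr_gt0 // invr_gt0.
rewrite !lt_min => /andP[tc _] /andP[_ uw] Au.
exists (t / c), (c *: u); split.
- by rewrite divr_gt0 //= ltr_pdivrMr.
- by rewrite -scalerBr normrZ gtr0_norm // mulrC -ltr_pdivlMr.
- by rewrite scalerA divfK // gt_eqF.
Qed.

Lemma tvec_velocity n (A : set 'rV[R]_n) x w : velocities A x w -> tvec A x w.
Proof.
move=> [e [c [e0 Cc cA c0 cw]]] h h0.
have [|dc _] := Cc 0; first by rewrite /= in_itv /= oppr_lt0 e0.
have h2 : 0 < h / 2 by rewrite divr_gt0.
have [r r0 rP] := diff_approx dc h2.
pose t := Num.min (Num.min e h) r / 2.
have m0 : 0 < Num.min (Num.min e h) r by rewrite !lt_min e0 h0.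
have t0 : 0 < t by rewrite divr_gt0.
have : t < Num.min (Num.min e h) r by rewrite /t; lra.
rewrite !lt_min => /andP[/andP[te th] tr].
have := rP t; rewrite subr0 gtr0_norm // => /(_ tr).
have -> : 'd c 0 t = t *: w.
  by rewrite -cw (derive1E' dc) -{1}[t]mulr1 -[t * 1]/(t *: (1 : R)) linearZ.
rewrite c0 => ct; exists t, (t^-1 *: (c t - x)); split; first by rewrite t0.
  have -> : t^-1 *: (c t - x) - w = t^-1 *: (c t - x - t *: w).
    by rewrite [in RHS]scalerBr scaler_posVK.
  rewrite normrZ gtr0_norm ?invr_gt0 // mulrC ltr_pdivrMr //.
  by rewrite (le_lt_trans ct) // ltr_pM2r //; lra.
rewrite scaler_posK // subrKC; apply: cA.
by rewrite in_itv /= te andbT; lra.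
Qed.

End Calculus.

(** * Local structure of a C1 submanifold *)

Section Charts.
Context {R : realType}.

Lemma linear_bound n m (f : {linear 'rV[R]_n -> 'rV[R]_m}) :
  exists2 C : R, 0 < C & forall w, `|f w| <= C * `|w|.
Proof.
exists (n%:R * `|lin1_mx f| + 1); first by rewrite ltr_wpDl // mulr_ge0.
move=> w; have := norm_mulmx_le w (lin1_mx f); rewrite mul_rV_lin1 => /le_trans; apply.
by rewrite mulrDl lerDl mul1r.
Qed.

Lemma le_of_eq (a b : R) : a = b -> a <= b.
Proof. by move=> ->. Qed.

Lemma continuous_norm (V W : normedModType R) (f : V -> W) x :
  (forall h : R, 0 < h -> exists2 r : R, 0 < r & forall y, `|y - x| < r -> `|f y - f x| <= h) ->
  {for x, continuous f}.
Proof.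
move=> fx; apply/cvgrPdist_le => h h0; have [r r0 rP] := fx h h0.
have : nbhs x (fun y => is_true (`|f x - f y| <= h)); last by [].
apply: (iffRL (nbhs_dist x _)); exists r; first exact: r0.
by move=> y yr; rewrite distrC; exact: rP y yr.
Qed.

Lemma diff_cont (V W : normedModType R) (f : V -> W) x (h : R) :
  differentiable f x -> 0 < h -> exists2 r : R, 0 < r &
    forall y, `|y - x| < r -> `|f y - f x| < h.
Proof.
move=> df h0; have cf : f @ x --> f x := differentiable_continuous df.
have /cvgrPdist_lt/(_ h h0)/nbhs_dist[r r0 rP] := cf.
exists r; first exact: r0.
by move=> y yr; rewrite distrC; exact: rP y yr.
Qed.

Lemma mul_pid_mxE n k (h : 'rV[R]_n) (i : 'I_n) :
  (h *m (pid_mx k : 'M[R]_n)) ord0 i = h ord0 i *+ (i < k)%N.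
Proof.
rewrite mxE (bigD1 i) //= big1 ?addr0 => [|j ji]; rewrite !mxE.
  by rewrite eqxx /= mulr_natr.
by rewrite (_ : (j == i :> nat) = false) ?mulr0 //; apply/negbTE.
Qed.

(** The subspace is the image of the idempotent [A *m pid_mx k *m B], whose
    trace is [k]. *)
Lemma flat_preimage n k (A B : 'M[R]_n) : (k <= n)%N -> A *m B = 1%:M -> B *m A = 1%:M ->
  exists T : {vspace 'rV[R]_n}, \dim T = k /\
    forall w, w \in T <-> forall i : 'I_n, (k <= i)%N -> (w *m A) ord0 i = 0.
Proof.
move=> kn AB BA; pose N := A *m pid_mx k *m B; exists (fixspace N).
have flat_pid (h : 'rV[R]_n) :
    (forall i : 'I_n, (k <= i)%N -> h ord0 i = 0) <-> h *m pid_mx k = h.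
  split=> [hf|hk i ki]; last by rewrite -hk mul_pid_mxE ltnNge ki mulr0n.
  apply/rowP => i; rewrite mul_pid_mxE; case: ltnP => [_|ki]; first by rewrite mulr1n.
  by rewrite hf.
have NN : N *m N = N.
  rewrite /N !mulmxA -(mulmxA _ B A) BA mulmx1 -(mulmxA A).
  by rewrite pid_mx_id.
split.
  apply/eqP; rewrite -(eqr_nat R) -fixspace_dim // /N mxtrace_mulC mulmxA BA.
  rewrite mul1mx /mxtrace (eq_bigr (fun i : 'I_n => (i < k)%N%:R)) => [|i _]; last first.
    by rewrite !mxE eqxx.
  rewrite -natr_sum; apply/eqP; congr (_%:R).
  rewrite -(big_mkord xpredT (fun i => nat_of_bool (i < k)%N)).
  rewrite (big_cat_nat (n := k)) //= big_nat_cond (eq_bigr (fun=> 1%N)); last first.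
    by move=> i /andP[/andP[_ ->]].
  rewrite -big_nat_cond sum_nat_const_nat subn0 muln1 big_nat_cond big1 ?addn0 //.
  by move=> i /andP[/andP[ki _] _]; rewrite ltnNge ki.
move=> w; rewrite mem_fixspace flat_pid /N !mulmxA; split=> [/eqP wN|wk].
  by rewrite -{2}wN -[RHS]mulmxA BA mulmx1.
by rewrite wk -mulmxA AB mulmx1.
Qed.

Section OneChart.
Context {n : nat} (k : nat) (M U V : set 'rV[R]_n) (phi psi : 'rV[R]_n -> 'rV[R]_n).
Hypothesis kn : (k <= n)%N.
Hypothesis (oU : open U) (oV : open V) (Cphi : C1_on U phi) (Cpsi : C1_on V psi).
Hypothesis phiU : forall y, U y -> V (phi y) /\ psi (phi y) = y.
Hypothesis psiV : forall z, V z -> U (psi z) /\ phi (psi z) = z.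
Hypothesis flatM : forall y, U y -> (M y <-> forall i : 'I_n, (k <= i)%N -> phi y ord0 i = 0).

Let flat (h : 'rV[R]_n) := forall i : 'I_n, (k <= i)%N -> h ord0 i = 0.

Let Dphi y : U y -> differentiable phi y.
Proof. by move=> /Cphi[]. Qed.

Let Dpsi y : U y -> differentiable psi (phi y).
Proof. by move=> /phiU[/Cpsi[]]. Qed.

Let psi_phi y w : U y -> 'd psi (phi y) ('d phi y w) = w.
Proof.
move=> Uy; have [r r0 rU] := open_norm_ball oU Uy.
have cE : 'd (psi \o phi) y w = 'd psi (phi y) ('d phi y w).
  exact: (congr1 (fun g => g w) (diff_comp (Dphi Uy) (Dpsi Uy))).
have iE : 'd (psi \o phi) y w = 'd (@id 'rV[R]_n) y w.
  apply: (@diff_ext_near _ 'rV[R]_n 'rV[R]_n _ _ _ r) => //.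
  - by move=> z /rU /phiU[].
  - exact: differentiable_comp (Dphi Uy) (Dpsi Uy).
apply: etrans (etrans (esym cE) iE) _.
by rewrite diff_val.
Qed.

Let phi_psi y w : U y -> 'd phi y ('d psi (phi y) w) = w.
Proof.
move=> Uy; have [Vy yE] := phiU Uy; have [r r0 rV] := open_norm_ball oV Vy.
have Dphi' : differentiable phi (psi (phi y)) by rewrite yE; exact: Dphi.
have cE : 'd (phi \o psi) (phi y) w = 'd phi (psi (phi y)) ('d psi (phi y) w).
  exact: (congr1 (fun g => g w) (diff_comp (Dpsi Uy) Dphi')).
have iE : 'd (phi \o psi) (phi y) w = 'd (@id 'rV[R]_n) (phi y) w.
  apply: (@diff_ext_near _ 'rV[R]_n 'rV[R]_n _ _ _ r) => //.
  - by move=> z /rV /psiV[].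
  - exact: differentiable_comp (Dpsi Uy) Dphi'.
rewrite yE in cE; apply: etrans (etrans (esym cE) iE) _.
by rewrite diff_val.
Qed.

Let tvec_flat y w : U y -> M y -> tvec M y w -> flat ('d phi y w).
Proof.
move=> Uy My tv i ki; apply/eqP; rewrite -normr_le0; apply/ler_addgt0Pr => h h0.
rewrite add0r; have [C C0 CP] := linear_bound ('d phi y).
pose h' := h / (`|w| + 1 + C).
have D0 : 0 < `|w| + 1 + C by rewrite addr_gt0 // ltr_wpDl.
have h'0 : 0 < h' by rewrite divr_gt0.
have [r r0 rP] := diff_approx (Dphi Uy) h'0.
have [q q0 qU] := open_norm_ball oU Uy.
have m0 : 0 < Num.min r q by rewrite lt_min r0.
have tvr : tvec (M `&` [set z | `|z - y| < Num.min r q]) y w.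
  by apply: tvec_local m0 _ tv => z zy Mz; split.
have [|t [u [/andP[t0 th] uw [Mu]]]] := tvr (Num.min h' 1); first by rewrite lt_min h'0 ltr01.
rewrite /= lt_min => /andP[ur uq]; rewrite lt_min in uw; case/andP: uw => uw u1.
have := rP _ ur; have yu : y + t *: u - y = t *: u by rewrite addrAC subrr add0r.
rewrite yu => /(le_trans (mx_entry_le _ ord0 i)).
have Uu := qU _ uq.
have -> : 'd phi y (t *: u) = t *: 'd phi y u by exact: linearZ.
rewrite !mxE (iffLR (flatM Uu) Mu i ki) (iffLR (flatM Uy) My i ki).
rewrite subrr add0r normrN normrM normrZ gtr0_norm // mulrCA ler_pM2l // => du.
have dw : `|('d phi y u - 'd phi y w) ord0 i| <= C * `|u - w|.
  have -> : 'd phi y u - 'd phi y w = 'd phi y (u - w).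
    by apply/esym; exact: linearB.
  exact: le_trans (mx_entry_le _ _ _) (CP _).
rewrite !mxE in dw.
have := ler_distD ('d phi y u ord0 i) 0 ('d phi y w ord0 i); rewrite !sub0r !normrN.
have := ler_normD (u - w) w; rewrite subrK => uw'.
have e1 : h' * `|u| <= h' * (`|w| + 1) by rewrite ler_wpM2l ?ltW //; lra.
have e2 : C * `|u - w| <= C * h' by rewrite ler_wpM2l ?ltW.
have : h' * (`|w| + 1 + C) = h by rewrite divfK // gt_eqF.
by move: du e1; rewrite !mulrDr mulr1; lra.
Qed.

Let flat_velocity y w : U y -> M y -> flat ('d phi y w) -> velocities M y w.
Proof.
move=> Uy My; set h := 'd phi y w => hflat.
have [Vy yE] := phiU Uy; have [r r0 rV] := open_norm_ball oV Vy.
pose c (s : R) := psi (phi y + s *: h).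
pose e := r / (`|h| + 1).
have h1 : 0 < `|h| + 1 by rewrite ltr_wpDl.
have e0 : 0 < e by rewrite divr_gt0.
have inV s : s \in `](- e), e[ -> V (phi y + s *: h).
  rewrite in_itv /= -ltr_norml => se; apply: rV.
  rewrite addrAC subrr add0r normrZ.
  have : `|s| * (`|h| + 1) < r by rewrite -ltr_pdivlMr.
  by apply: le_lt_trans; rewrite mulrDr lerDl mulr_ge0.
have dc s : s \in `](- e), e[ -> differentiable c s /\
    forall t, 'd c s t = t *: 'd psi (phi y + s *: h) h.
  by move=> /inV Vs; apply: diff_along; have [] := Cpsi Vs.
have c0 : c 0 = y by rewrite /c scale0r addr0.
have zin : 0 \in `](- e), e[ by rewrite in_itv /= oppr_lt0 e0.
exists e, c; split=> //.
- move=> s; rewrite [X in X -> _]/= => sin; split; first exact: (dc s sin).1.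
  move=> t; apply: continuous_norm => b b0.
  have a0 : 0 < b / (`|t| * `|h| + 1) by rewrite divr_gt0 // ltr_wpDl // mulr_ge0.
  have [q q0 qP] := C1_diff_near oV Cpsi (inV s sin) a0.
  have [p p0 pin] : exists2 p : R, 0 < p & forall u, `|u - s| < p -> u \in `](- e), e[.
    move: sin; rewrite in_itv /= => /andP[s1 s2]; exists (Num.min (s + e) (e - s)).
      by rewrite lt_min; apply/andP; split; lra.
    move=> u; rewrite lt_min !ltr_norml in_itv /= => /andP[/andP[u1 u2] /andP[u3 u4]].
    by apply/andP; split; lra.
  exists (Num.min p (q / (`|h| + 1))); first by rewrite lt_min p0 divr_gt0.
  move=> u; rewrite lt_min => /andP[/pin uin uq].
  have dE : `|'d c u t - 'd c s t| =
      `|t| * `|'d psi (phi y + u *: h) h - 'd psi (phi y + s *: h) h|.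
    have := congr2 (fun a b => `|a - b|) ((dc u uin).2 t) ((dc s sin).2 t).
    by move=> E; apply: etrans E _; rewrite -scalerBr; exact: normrZ.
  apply: le_trans (le_of_eq dE) _.
  have [|_ /(_ h) du] := qP (phi y + u *: h).
    have -> : phi y + u *: h - (phi y + s *: h) = (u - s) *: h.
      by apply/rowP => i; rewrite !mxE; ring.
    rewrite normrZ; move: uq; rewrite ltr_pdivlMr //.
    by apply: le_lt_trans; rewrite mulrDr lerDl mulr_ge0.
  apply: le_trans (ler_wpM2l (normr_ge0 t) du) _.
  have D0 : 0 < `|t| * `|h| + 1 by rewrite ltr_wpDl // mulr_ge0.
  have -> : `|t| * (b / (`|t| * `|h| + 1) * `|h|) = b * (`|t| * `|h| / (`|t| * `|h| + 1)).
    by ring.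
  rewrite -[leRHS]mulr1; apply: ler_wpM2l; first exact: ltW.
  by rewrite ler_pdivrMr // mul1r lerDl.
- move=> t tin; have [Ut tE] := psiV (inV t tin).
  apply/(flatM Ut) => i ki; rewrite tE !mxE (hflat i ki) mulr0 addr0.
  exact: (iffLR (flatM Uy) My i ki).
- rewrite (derive1E' (dc 0 zin).1); apply: etrans ((dc 0 zin).2 1) _.
  rewrite scale1r scale0r addr0; exact: psi_phi.
Qed.

Let J y := lin1_mx ('d phi y).
Let J' y := lin1_mx ('d psi (phi y)).

Let JE y w : w *m J y = 'd phi y w. Proof. exact: mul_rV_lin1. Qed.
Let JE' y w : w *m J' y = 'd psi (phi y) w. Proof. exact: mul_rV_lin1. Qed.

Let JJ' y : U y -> J y *m J' y = 1%:M.
Proof.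
move=> Uy; apply/row_matrixP => i; rewrite row_mul JE' row1 rowE JE.
exact: psi_phi.
Qed.

Let J'J y : U y -> J' y *m J y = 1%:M.
Proof.
move=> Uy; apply/row_matrixP => i; rewrite row_mul JE row1 rowE JE'.
exact: phi_psi.
Qed.

Let tspace y : U y -> exists T : {vspace 'rV[R]_n}, \dim T = k /\
  forall w, w \in T <-> flat ('d phi y w).
Proof.
move=> Uy; have [T [dT TP]] := flat_preimage kn (JJ' Uy) (J'J Uy).
exists T; split=> // w; rewrite TP; split=> fw i ki.
  by have := fw i ki; rewrite JE.
by rewrite JE fw.
Qed.

Let tvecP y w : U y -> M y -> tvec M y w <-> flat ('d phi y w).
Proof.
move=> Uy My; split; first exact: tvec_flat.
by move=> fw; apply: tvec_velocity; exact: flat_velocity.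
Qed.

Lemma chart_tangent_aux x : U x -> M x ->
  exists T : {vspace 'rV[R]_n}, [/\ \dim T = k, forall w, w \in T <-> tvec M x w &
    forall w, w \in T -> velocities M x w].
Proof.
move=> Ux Mx; have [T [dT TP]] := tspace Ux; exists T; split=> // w.
  by rewrite TP tvecP.
by move=> /TP; exact: flat_velocity.
Qed.

Lemma chart_secant_aux x h : U x -> M x -> 0 < h -> exists2 r : R, 0 < r &
  forall y z, `|y - x| < r -> `|z - x| < r -> M y -> M z ->
    exists2 w, tvec M x w & `|z - y - w| <= h * `|z - y|.
Proof.
move=> Ux Mx h0; have [C C0 CP] := linear_bound ('d psi (phi x)).
have [r r0 rP] := C1_strict oU Cphi Ux (divr_gt0 h0 C0).
have [q q0 qU] := open_norm_ball oU Ux.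
exists (Num.min r q); first by rewrite lt_min r0.
move=> y z; rewrite !lt_min => /andP[yr /qU Uy] /andP[zr /qU Uz] My Mz.
exists ('d psi (phi x) (phi z - phi y)).
  apply/(tvecP _ Ux Mx) => i ki; rewrite phi_psi // !mxE.
  by rewrite (iffLR (flatM Uy) My i ki) (iffLR (flatM Uz) Mz i ki) subrr.
have -> : z - y - 'd psi (phi x) (phi z - phi y) =
    - 'd psi (phi x) (phi z - phi y - 'd phi x (z - y)).
  rewrite (linearB ('d psi (phi x)) (phi z - phi y)) opprB.
  by congr (_ - _); apply/esym; exact: psi_phi.
rewrite normrN; apply: le_trans (CP _) _.
have /(ler_wpM2l (ltW C0)) /le_trans := rP y z yr zr; apply.
by rewrite mulrA mulrCA divff ?mulr1 // gt_eqF.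
Qed.

Lemma chart_transport_aux x h : U x -> M x -> 0 < h -> exists2 r : R, 0 < r &
  forall y, `|y - x| < r -> M y ->
    (forall w, tvec M x w -> exists2 w', tvec M y w' & `|w' - w| <= h * `|w|) /\
    (forall w', tvec M y w' -> exists2 w, tvec M x w & `|w' - w| <= h * `|w'|).
Proof.
move=> Ux Mx h0; have [C C0 CP] := linear_bound ('d phi x).
have C1 : 0 < C + 1 by rewrite addr_gt0.
have [Vx _] := phiU Ux.
have [r r0 rP] := C1_diff_near oV Cpsi Vx (divr_gt0 h0 C1).
have [p p0 pP] := C1_diff_near oU Cphi Ux ltr01.
have [q q0 qP] := diff_cont (Dphi Ux) r0.
exists (Num.min p q); first by rewrite lt_min p0.
move=> y; rewrite lt_min => /andP[/pP[Uy dy] /qP/rP[_ dpsi]] My.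
have small w' t : `|t| <= (C + 1) * `|w'| -> h / (C + 1) * `|t| <= h * `|w'|.
  move=> tw; apply: le_trans (ler_wpM2l (ltW (divr_gt0 h0 C1)) tw) _.
  by rewrite mulrA divfK // gt_eqF.
split=> [w /(tvecP _ Ux Mx) fw|w' /(tvecP _ Uy My) fw].
  exists ('d psi (phi y) ('d phi x w)).
    by apply/(tvecP _ Uy My) => i ki; rewrite phi_psi // fw.
  rewrite -{2}(psi_phi w Ux); apply: le_trans (dpsi _) _.
  apply: small; apply: le_trans (CP w) _.
  by rewrite ler_wpM2r // lerDl.
exists ('d psi (phi x) ('d phi y w')).
  by apply/(tvecP _ Ux Mx) => i ki; rewrite phi_psi // fw.
rewrite -{1}(psi_phi w' Uy); apply: le_trans (dpsi _) _.
apply: small; have := ler_normD ('d phi y w' - 'd phi x w') ('d phi x w').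
rewrite subrK => /le_trans; apply; rewrite mulrDl addrC; apply: lerD; first exact: CP.
by have := dy w'; rewrite !mul1r.
Qed.

End OneChart.

Lemma chart_tangent n k (M : set 'rV[R]_n) x : has_C1_chart k M x -> M x ->
  exists T : {vspace 'rV[R]_n}, [/\ \dim T = k, forall w, w \in T <-> tvec M x w &
    forall w, w \in T -> velocities M x w].
Proof.
move=> [kn [U [V [phi [psi [[oU oV] Ux [Cphi Cpsi] [pU pV] fM]]]]]].
exact: (@chart_tangent_aux n k M U V phi psi).
Qed.

(** Continuity of the tangent spaces, and strict differentiability, around a
    point of a C1 submanifold. *)
Lemma chart_flat n k (M : set 'rV[R]_n) x h : has_C1_chart k M x -> M x -> 0 < h ->
  exists2 r : R, 0 < r &
    (forall y z, `|y - x| < r -> `|z - x| < r -> M y -> M z ->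
      exists2 w, tvec M x w & `|z - y - w| <= h * `|z - y|) /\
    (forall y, `|y - x| < r -> M y ->
      (forall w, tvec M x w -> exists2 w', tvec M y w' & `|w' - w| <= h * `|w|) /\
      (forall w', tvec M y w' -> exists2 w, tvec M x w & `|w' - w| <= h * `|w'|)).
Proof.
move=> [kn [U [V [phi [psi [[oU oV] Ux [Cphi Cpsi] [pU pV] fM]]]]]] Mx h0.
have [r r0 rP] := @chart_secant_aux n k M U V phi psi oU oV Cphi Cpsi pU pV fM x h Ux Mx h0.
have [q q0 qP] := @chart_transport_aux n k M U V phi psi oU oV Cphi Cpsi pU pV fM x h Ux Mx h0.
exists (Num.min r q); first by rewrite lt_min r0.
split=> [y z|y]; rewrite !lt_min => /andP[yr yq]; last exact: qP.
by move=> /andP[zr zq]; exact: rP.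
Qed.

Lemma chart_restrict n k (M O : set 'rV[R]_n) x : open O -> O x ->
  has_C1_chart k M x -> has_C1_chart k (M `&` O) x.
Proof.
move=> oO Ox [kn [U [V [phi [psi [[oU oV] Ux [Cphi Cpsi] [pU pV] fM]]]]]].
split=> //; exists (U `&` O), (V `&` psi @^-1` O), phi, psi; split=> //.
- split; first exact: openI.
  rewrite openE => z [Vz Oz]; apply: filterI; first exact: open_nbhs_nbhs.
  have [/differentiable_continuous cpsi _] := Cpsi z Vz.
  by apply: cpsi; exact: open_nbhs_nbhs.
- by split=> [y [Uy _]|z [Vz _]]; [exact: Cphi|exact: Cpsi].
- split=> [y [Uy Oy]|z [Vz Oz]].
    by have [Vy yE] := pU y Uy; split=> //; split=> //=; rewrite yE.
  by have [Uz zE] := pV z Vz; split.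
- by move=> y [Uy Oy]; rewrite -fM //; split=> [[]|].
Qed.

Lemma submanifold_restrict n k (M O : set 'rV[R]_n) : open O ->
  C1_submanifold k M -> C1_submanifold k (M `&` O).
Proof. by move=> oO Mk x [Mx Ox]; apply: chart_restrict => //; exact: Mk. Qed.

Lemma submanifold_dim_le n k l (M N : set 'rV[R]_n) x : C1_submanifold k M ->
  C1_submanifold l N -> M x -> M `<=` N -> (k <= l)%N.
Proof.
move=> Mk Nl Mx MN.
have [T [<- TP _]] := chart_tangent (Mk x Mx) Mx.
have [T' [<- TP' _]] := chart_tangent (Nl x (MN x Mx)) (MN x Mx).
apply: dimvS; apply/subvP => w /TP tw; apply/TP'.
exact: tvec_sub tw.
Qed.

(** At a regular point velocities, tangent vectors and the kernel of the last
    coordinates of a chart agree; they form the subspace selected by [tangent_space]. *)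
Lemma reg_tangent n (A : set 'rV[R]_n) x : reg A x ->
  (forall w, w \in tangent_space A x <-> tvec A x w) /\
  exists U, [/\ open U, U x & C1_submanifold (\dim (tangent_space A x)) (A `&` U)].
Proof.
move=> [Ax [U [k [oU Ux Mk]]]].
have AUx : (A `&` U) x by [].
have [T [dT TP TV]] := chart_tangent (Mk x AUx) AUx.
have tvU w : tvec A x w <-> tvec (A `&` U) x w.
  split; last by apply: tvec_sub => y [].
  have [r r0 rU] := open_norm_ball oU Ux.
  by apply: tvec_local r0 _ => y /rU.
have velE : [set` T] = velocities A x.
  apply/seteqP; split=> w /=.
    move=> /TV[e [c [e0 Cc cA c0 cw]]]; exists e, c.
    by split=> // t /cA[].
  by move=> /tvec_velocity/tvU/TP.
have spE : [set` tangent_space A x] = velocities A x.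
  exact: (xgetPex 0%VS (ex_intro (fun S : {vspace 'rV[R]_n} => [set` S] = velocities A x) T velE)).
have -> : tangent_space A x = T.
  apply/vspaceP => w; apply/idP/idP => wT.
    have : [set` T] w by rewrite velE -spE.
    by [].
  have : [set` tangent_space A x] w by rewrite spE -velE.
  by [].
split=> [w|]; first by rewrite TP tvU.
by exists U; rewrite dT.
Qed.

End Charts.

(** * Sheets of a set whose tangent spaces are close to a plane *)

Section Sheets.
Context {R : realType}.

Lemma bounded_cluster n (u : nat -> 'rV[R]_n) (C : R) : (forall k, `|u k| <= C) ->
  exists l, forall h N, 0 < h -> exists2 k, (N <= k)%N & `|u k - l| < h.
Proof.
move=> uC; pose A := [set x : 'rV[R]_n | `|x| <= C].
have cA : compact A.
  apply: bounded_closed_compact.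
    by exists C; split; [exact: num_real|move=> M CM x /le_trans; apply; exact: ltW].
  have -> : A = Num.norm @^-1` [set x | x <= C] by [].
  by apply: preimage_closed (@closed_le R C) => x _; exact: norm_continuous.
have [|l [_ cl]] := cA (u @ \oo) _; first by exists 0%N => // k _ /=; exact: uC.
exists l => h N h0; have [||x [[k Nk <-] ul]] :=
    cl (u @` [set k | (N <= k)%N]) [set x | `|x - l| < h].
- by exists N => // k Nk; exists k.
- by apply/nbhs_dist; exists h.
by exists k.
Qed.

Lemma bounded_cluster_mx n (u : nat -> 'M[R]_n) (C : R) : (forall k, `|u k| <= C) ->
  exists l, forall h N, 0 < h -> exists2 k, (N <= k)%N & `|u k - l| < h.
Proof.
move=> uC; have C0 : 0 <= C by apply: le_trans (uC 0%N).
have [k|l lP] := @bounded_cluster _ (fun k => mxvec (u k)) C.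
  apply: rV_norm_le => // i; case/mxvec_indexP: i => i j; rewrite mxvecE.
  exact: le_trans (mx_entry_le _ _ _) (uC k).
exists (vec_mx l) => h N h0; have [k Nk ukl] := lP h N h0; exists k => //.
apply: le_lt_trans ukl; apply: mx_norm_le => // i j.
have -> : (u k - vec_mx l) i j = (mxvec (u k) - l) ord0 (mxvec_index i j).
  by rewrite -{2}(vec_mxK l) -linearB mxvecE.
exact: mx_entry_le.
Qed.

Lemma lipschitz_continuous n (f : 'rV[R]_n -> R) (C : R) : 0 <= C ->
  (forall y z, `|f z - f y| <= C * `|z - y|) -> continuous f.
Proof.
move=> C0 fC y; apply: continuous_norm => h h0.
have C1 : 0 < C + 1 by rewrite ltr_wpDl.
exists (h / (C + 1)); first by rewrite divr_gt0.
move=> z; rewrite ltr_pdivlMr // => zy; apply: le_trans (fC y z) _.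
by move: zy; rewrite mulrDr mulr1 mulrC; have := normr_ge0 (z - y); lra.
Qed.

Lemma norm_dist_lipschitz n (L : 'M[R]_n) (a : 'rV[R]_n) y z :
  `| `|z *m L - a| - `|y *m L - a| | <= n%:R * `|L| * `|z - y|.
Proof.
apply: le_trans (ler_dist_dist _ _) _.
have -> : z *m L - a - (y *m L - a) = (z - y) *m L.
  by rewrite mulmxBl; apply/rowP => i; rewrite !mxE; ring.
exact: norm_mulmx_le.
Qed.

Lemma norm_dist_cont n (L : 'M[R]_n) (a : 'rV[R]_n) :
  continuous (fun y : 'rV[R]_n => `|y *m L - a|).
Proof.
apply: (@lipschitz_continuous n _ (n%:R * `|L|)); first by rewrite mulr_ge0.
exact: norm_dist_lipschitz.
Qed.

(** A compact set all of whose points admit a tangent vector that decreases the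
    distance of the [L]-image to [a], at a definite rate compared with its
    length, reaches [a]: where the sum of the distance and of a penalty on the
    displacement from [y0] is minimal, the distance cannot be positive. *)
Lemma descent n (K : set 'rV[R]_n) (L Q : 'M[R]_n) (k m : R) (y0 a : 'rV[R]_n) :
  compact K -> K y0 -> 0 <= k -> 0 <= m ->
  (forall y, K y -> y *m L <> a ->
     k * `|y - y0| + m * `|(y - y0) *m Q| <= `|y0 *m L - a| ->
     exists2 w, tvec K y w &
       `|y *m L - a + w *m L| + k * `|w| + m * `|w *m Q| < `|y *m L - a|) ->
  exists y, [/\ K y, y *m L = a & k * `|y - y0| + m * `|(y - y0) *m Q| <= `|y0 *m L - a|].
Proof.
move=> cK Ky0 k0 m0 desc.
pose F (y : 'rV[R]_n) := `|y *m L - a| + k * `|y - y0| + m * `|(y - y0) *m Q|.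
pose BL := n%:R * `|L|; pose BQ := n%:R * `|Q|.
have BL0 : 0 <= BL by rewrite mulr_ge0.
have BQ0 : 0 <= BQ by rewrite mulr_ge0.
have FE y : F y = `|y *m L - a| + k * `|y - y0| + m * `|(y - y0) *m Q| by [].
have cF : continuous F.
  apply: (@lipschitz_continuous n _ (BL + k + m * BQ)).
    by rewrite !addr_ge0 // mulr_ge0.
  move=> y z; have l1 := norm_dist_lipschitz L a y z.
  have l2 := ler_dist_dist (z - y0) (y - y0).
  have l3 := norm_dist_lipschitz Q (y0 *m Q) y z; rewrite -!mulmxBl in l3.
  have zy : z - y0 - (y - y0) = z - y by apply/rowP => i; rewrite !mxE; ring.
  rewrite zy in l2; move: l1 l2 l3; rewrite !ler_norml /F -/BL -/BQ.
  move=> /andP[a1 a2] /andP[b1 b2] /andP[c1 c2].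
  have := ler_wpM2l k0 b1; have := ler_wpM2l k0 b2.
  have := ler_wpM2l m0 c1; have := ler_wpM2l m0 c2.
  rewrite !mulrBr !mulrN => d1 d2 d3 d4; rewrite !mulrDl -(mulrA m).
  by apply/andP; split; lra.
have [||y] := EVT_min_rV (f := F) (A := K) _ cK; first by exists y0.
  exact: continuous_subspaceT.
rewrite inE => Ky minF; exists y.
have Fy0 : F y <= `|y0 *m L - a|.
  apply: le_trans (minF y0 _) _; first by rewrite inE.
  by rewrite FE !subrr mul0mx !normr0 !mulr0 !addr0.
have yd : k * `|y - y0| + m * `|(y - y0) *m Q| <= `|y0 *m L - a|.
  by apply: le_trans Fy0; rewrite FE -addrA lerDr.
split=> //; apply: contrapT => ya; have [w tw wd] := desc y Ky ya yd.
set g := `|y *m L - a| - (`|y *m L - a + w *m L| + k * `|w| + m * `|w *m Q|).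
have g0 : 0 < g by rewrite subr_gt0.
(* Along a step [t *: u] with [u] close to [w] the function loses [t * g] to the
   first order, and the error is at most [t * E * `|u - w|]. *)
pose E := BL + k + m * BQ + 1.
have E0 : 0 < E by rewrite ltr_wpDl // !addr_ge0 // mulr_ge0.
have [|t [u [/andP[t0 th] uw Ku]]] := tw (Num.min 1 (g / E)).
  by rewrite lt_min ltr01 divr_gt0.
move: th uw; rewrite !lt_min => /andP[t1 _] /andP[_ uw].
have := minF (y + t *: u); rewrite inE => /(_ Ku); apply/negP; rewrite -ltNge !FE.
have n1 : `|(y + t *: u) *m L - a| <= (1 - t) * `|y *m L - a| +
    t * `|y *m L - a + w *m L| + t * (BL * `|u - w|).
  have -> : (y + t *: u) *m L - a = (1 - t) *: (y *m L - a) +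
      t *: (y *m L - a + w *m L) + t *: ((u - w) *m L).
    rewrite mulmxDl -scalemxAl mulmxBl.
    by apply/rowP => i; rewrite [in LHS]mxE [in RHS]mxE; rewrite !mxE; ring.
  apply: le_trans (ler_normD _ _) _; apply: lerD.
    apply: le_trans (ler_normD _ _) _.
    by rewrite !normrZ (gtr0_norm t0) ger0_norm // subr_ge0 ltW.
  by rewrite normrZ (gtr0_norm t0) ler_pM2l // norm_mulmx_le.
have n2 : `|y + t *: u - y0| <= `|y - y0| + t * `|w| + t * `|u - w|.
  have -> : y + t *: u - y0 = y - y0 + t *: w + t *: (u - w).
    by apply/rowP => i; rewrite !mxE; ring.
  apply: le_trans (ler_normD _ _) _; rewrite [`|t *: (u - w)|]normrZ (gtr0_norm t0) lerD2r.
  by apply: le_trans (ler_normD _ _) _; rewrite normrZ (gtr0_norm t0).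
have n3 : `|(y + t *: u - y0) *m Q| <= `|(y - y0) *m Q| + t * `|w *m Q| + t * (BQ * `|u - w|).
  have -> : (y + t *: u - y0) *m Q = (y - y0) *m Q + t *: (w *m Q) + t *: ((u - w) *m Q).
    rewrite !scalemxAl -!mulmxDl; congr (_ *m _).
    by apply/rowP => i; rewrite !mxE; ring.
  apply: le_trans (ler_normD _ _) _.
  apply: lerD; last by rewrite normrZ (gtr0_norm t0) ler_pM2l // norm_mulmx_le.
  by apply: le_trans (ler_normD _ _) _; rewrite normrZ (gtr0_norm t0).
have e2 := ler_wpM2l k0 n2; have e3 := ler_wpM2l m0 n3.
have uE : t * (`|u - w| * E) < t * g by rewrite ltr_pM2l // -ltr_pdivlMr.
have tu : 0 <= t * `|u - w| by rewrite mulr_ge0 // ltW.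
move: uE n1 e2 e3; rewrite /E /g.
lra.
Qed.

(** A bound for the action, in the sup norm, of an orthogonal projection and of
    the complementary one. *)
Definition proj_bound (n : nat) : R := 2 * n%:R + 1.

Lemma proj_bound_ge1 n : 1 <= proj_bound n.
Proof. by rewrite /proj_bound lerDr mulr_ge0. Qed.

Lemma proj_bound_gt0 n : 0 < proj_bound n.
Proof. exact: lt_le_trans ltr01 (proj_bound_ge1 n). Qed.

Definition oproj n (P : {vspace 'rV[R]_n}) : 'M[R]_n := 1%:M - orthoproj P.

Lemma orthoproj_le n (P : {vspace 'rV[R]_n}) (x : 'rV[R]_n) :
  `|x *m orthoproj P| <= proj_bound n * `|x|.
Proof.
apply: le_trans (norm_mulmx_le _ _) _; apply: ler_wpM2r => //.
have : n%:R * `|orthoproj P| <= n%:R * 1 by rewrite ler_wpM2l // orthoproj_norm_le.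
by rewrite /proj_bound; have := ler0n R n; lra.
Qed.

Lemma oproj_le n (P : {vspace 'rV[R]_n}) (x : 'rV[R]_n) : `|x *m oproj P| <= proj_bound n * `|x|.
Proof.
rewrite /oproj mulmxBr mulmx1; apply: le_trans (ler_normB _ _) _.
have := norm_mulmx_le x (orthoproj P).
have : n%:R * `|orthoproj P| * `|x| <= n%:R * 1 * `|x|.
  by rewrite ler_wpM2r // ler_wpM2l // orthoproj_norm_le.
have : 0 <= n%:R * `|x| by rewrite mulr_ge0.
rewrite /proj_bound mulrDl mul1r mulr1 -mulrA; lra.
Qed.

Lemma proj_split n (P : {vspace 'rV[R]_n}) (x : 'rV[R]_n) : x = x *m orthoproj P + x *m oproj P.
Proof. by rewrite -mulmxDr /oproj subrKC mulmx1. Qed.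

Lemma oproj_mem0 n (P : {vspace 'rV[R]_n}) (x : 'rV[R]_n) : x \in P <-> x *m oproj P = 0.
Proof.
split=> [xP|x0]; first by rewrite /oproj mulmxBr mulmx1 orthoproj_id // subrr.
by rewrite (proj_split P x) x0 addr0 orthoproj_mem.
Qed.

(** The part of [Y] through [x] behaves as the graph over [P] of a function of
    slope at most [1 / M]. In [descent] the penalty [1 / 4] on the displacement
    keeps the minimum inside the ball, and the penalty [M] on its component
    orthogonal to [P] bounds the slope; tangent vectors close to [P] still
    decrease the sum. *)
Lemma sheet n (Y : set 'rV[R]_n) (P : {vspace 'rV[R]_n}) (c : 'rV[R]_n) (r e M : R) :
  closed Y -> 0 < r -> 1 <= M -> 0 <= e -> 8 * proj_bound n * M * e <= 1 ->
  (forall y, Y y -> `|y - c| < r -> forall p, p \in P ->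
     exists2 w, tvec Y y w & `|w - p| <= e * `|p|) ->
  forall x a, Y x -> `|x - c| <= r / 2 -> a \in P -> `|a - x *m orthoproj P| <= r / 16 ->
  exists x', [/\ Y x', x' *m orthoproj P = a, `|x' - x| <= 4 * `|a - x *m orthoproj P| &
     M * `|(x' - x) *m oproj P| <= `|a - x *m orthoproj P|].
Proof.
move=> cY r0 M1 e0 eM tY x a Yx xc aP ax.
have B1 := proj_bound_ge1 n.
have M0 : 0 < M by exact: lt_le_trans ltr01 M1.
have BM : 1 <= proj_bound n * M by rewrite -[leLHS]mulr1; apply: ler_pM.
have Be : proj_bound n * e <= 1 / 8.
  have : 8 * (proj_bound n * e) * 1 <= 8 * (proj_bound n * e) * M.
    by rewrite ler_wpM2l // !mulr_ge0 // (le_trans ler01).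
  by move: eM; rewrite (_ : 8 * proj_bound n * M * e = 8 * (proj_bound n * e) * M); [lra|ring].
have MBe : M * (proj_bound n * e) <= 1 / 8 by move: eM; rewrite -!mulrA; lra.
have e8 : e <= 1 / 8.
  by apply: le_trans Be; rewrite ler_peMl.
pose K := Y `&` [set y | `|y - c| <= r].
have cK : compact K.
  apply: bounded_closed_compact.
    exists (`|c| + r); split; first exact: num_real.
    move=> b b1 y [_ yc]; apply: le_trans (ltW b1).
    by have := ler_normD (y - c) c; rewrite subrK /= in yc *; lra.
  apply: closedI => //; have -> : [set y | `|y - c| <= r] =
      (fun y => `|y *m 1%:M - c|) @^-1` [set x | x <= r].
    by apply/seteqP; split=> y; rewrite /= mulmx1.
  by apply: preimage_closed (@closed_le R r) => y _; exact: norm_dist_cont.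
have Kx : K x by split=> //=; lra.
have k4 : 0 <= 1 / 4 :> R by rewrite divr_ge0.
have [y [Yy _] yP yd|y [[Yy _] ya yd]] :=
    descent (L := orthoproj P) (Q := oproj P) (k := 1 / 4) (a := a) cK Kx k4 (ltW M0).
  set p := a - y *m orthoproj P.
  have pP : p \in P by rewrite rpredB // orthoproj_mem.
  have yx : `|y - x| <= r / 4.
    have := mulr_ge0 (ltW M0) (normr_ge0 ((y - x) *m oproj P)).
    by move: yd; rewrite [`|x *m _ - a|]distrC; lra.
  have yc : `|y - c| < r.
    by have := ler_normD (y - x) (x - c); rewrite addrA subrK; lra.
  have [w tw wp] := tY y Yy yc p pP; exists w.
    apply: (tvec_local (r := r - `|y - c|)) tw; first by rewrite subr_gt0.
    move=> z zy Yz; split=> //=.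
    by have := ler_normD (z - y) (y - c); rewrite addrA subrK; lra.
  have p0 : 0 < `|p|.
    by rewrite normr_gt0 subr_eq0; apply/eqP => ap; apply: yP.
  have -> : y *m orthoproj P - a = - p by rewrite opprB.
  have -> : - p + w *m orthoproj P = (w - p) *m orthoproj P.
    by rewrite mulmxBl (orthoproj_id pP) addrC.
  have -> : w *m oproj P = (w - p) *m oproj P.
    by rewrite mulmxBl (iffLR (oproj_mem0 P p) pP) subr0.
  have w1 : `|w| <= (1 + e) * `|p|.
    by have := ler_normD (w - p) p; rewrite subrK; lra.
  have h1 := le_trans (orthoproj_le P (w - p)) (ler_wpM2l (ltW (proj_bound_gt0 n)) wp).
  have h2 := le_trans (oproj_le P (w - p)) (ler_wpM2l (ltW (proj_bound_gt0 n)) wp).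
  have {}h2 := ler_wpM2l (ltW M0) h2.
  have q1 : proj_bound n * (e * `|p|) <= 1 / 8 * `|p| by rewrite mulrA ler_wpM2r.
  have q2 : M * (proj_bound n * (e * `|p|)) <= 1 / 8 * `|p|.
    by rewrite (_ : M * _ = M * (proj_bound n * e) * `|p|); [rewrite ler_wpM2r|ring].
  have q3 : (1 + e) * `|p| <= (1 + 1 / 8) * `|p| by rewrite ler_wpM2r // lerD2l.
  rewrite normrN; lra.
rewrite [`|x *m _ - a|]distrC in yd.
exists y; split=> //.
  have := mulr_ge0 (ltW M0) (normr_ge0 ((y - x) *m oproj P)); lra.
have := normr_ge0 (y - x); lra.
Qed.

End Sheets.

(** * Regular points of a definable set and of its closure *)

Section RegularPoints.
Context {R : realType}.

(** Near a regular point of the closure, the orthogonal projection to the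
    tangent space is injective on the closure and its image is a neighbourhood.
    The projection of [X], being definable and dense in this image, contains a
    ball, above which [X] and its closure agree. *)
Lemma regular_closure_approx (D : ominimal_structure R) n (X : set 'rV[R]_n) y (q : R) :
  definable D X -> reg (closure X) y -> 0 < q ->
  exists x, [/\ X x, `|x - y| < q &
    exists2 s : R, 0 < s & forall z, `|z - x| < s -> closure X z -> X z].
Proof.
move=> dX ry q0; have [TP [U [oU Uy Uk]]] := reg_tangent ry.
set P := tangent_space (closure X) y in TP Uk *.
have Yy : closure X y by case: ry.
have cY : closed (closure X) by exact: closed_closure.
pose e := (8 * proj_bound n)^-1 : R.
have B1 : 1 <= proj_bound n :> R := proj_bound_ge1 n.
have B0 : 0 < proj_bound n :> R := proj_bound_gt0 n.
have e0 : 0 < e by rewrite invr_gt0 mulr_gt0.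
have eB : 8 * proj_bound n * 1 * e <= 1 by rewrite mulr1 divff // gt_eqF // mulr_gt0.
have YUy : (closure X `&` U) y by [].
have [r r0 [sec tra]] := chart_flat (Uk y YUy) YUy e0.
have [u u0 uU] := open_norm_ball oU Uy.
have tvU z w : U z -> tvec (closure X `&` U) z w <-> tvec (closure X) z w.
  move=> Uz; split; first by apply: tvec_sub => ? [].
  have [p p0 pU] := open_norm_ball oU Uz.
  by apply: tvec_local p0 _ => ? /pU.
pose r1 := Num.min q (Num.min r u).
have r10 : 0 < r1 by rewrite !lt_min q0 r0.
have [r1q r1r r1u] : [/\ r1 <= q, r1 <= r & r1 <= u].
  by rewrite /r1; split; rewrite !ge_min lexx ?orbT.
have inj x z : closure X x -> closure X z -> `|x - y| < r1 -> `|z - y| < r1 ->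
    x *m orthoproj P = z *m orthoproj P -> x = z.
  move=> Yx Yz xy zy xz.
  have [||||w tw wd] := sec x z; try exact: lt_le_trans r1r.
  - by split=> //; apply: uU; exact: lt_le_trans r1u.
  - by split=> //; apply: uU; exact: lt_le_trans r1u.
  have wP : w \in P by apply/TP; apply/tvU.
  have wE : w = - ((z - x - w) *m orthoproj P).
    by rewrite !mulmxBl xz subrr sub0r opprK orthoproj_id.
  have w1 : `|w| <= proj_bound n * (e * `|z - x|).
    rewrite {1}wE normrN; apply: le_trans (orthoproj_le _ _) _.
    by rewrite ler_pM2l.
  have : `|z - x| <= `|z - x - w| + `|w| by rewrite -{1}[z - x](subrK w) ler_normD.
  have Be : proj_bound n * (e * `|z - x|) = 1 / 8 * `|z - x|.
    by rewrite /e; field; rewrite gt_eqF.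
  have : e * `|z - x| <= proj_bound n * (e * `|z - x|) by rewrite ler_peMl // mulr_ge0 // ltW.
  have := normr_ge0 (z - x) => n0 b1 b2; apply/esym/eqP; rewrite -subr_eq0 -normr_le0; lra.
have tY z : closure X z -> `|z - y| < r1 -> forall p, p \in P ->
    exists2 w, tvec (closure X) z w & `|w - p| <= e * `|p|.
  move=> Yz zy p pP; have Uz : U z by apply: uU; exact: lt_le_trans r1u.
  have YUz : (closure X `&` U) z by [].
  have [tra1 _] := tra z (lt_le_trans zy r1r) YUz.
  have [|w tw wp] := tra1 p; first by apply/tvU => //; apply/TP.
  by exists w => //; apply/(tvU z).
have yy : `|y - y| <= r1 / 2 by rewrite subrr normr0 divr_ge0 // ltW.
have sh a : a \in P -> `|a - y *m orthoproj P| <= r1 / 16 ->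
    exists2 x', closure X x' & x' *m orthoproj P = a /\ `|x' - y| <= 4 * `|a - y *m orthoproj P|.
  move=> aP ay.
  have [x' [Yx' xa x4 _]] := sheet cY r10 (lexx 1) (ltW e0) eB tY Yy yy aP ay.
  by exists x'.
(* The projection of [X], thickened in the directions orthogonal to the tangent
   space so as to stay in the same ambient space. *)
pose A := [set z | exists x, X x /\ `|x - y| < r1 /\ x *m orthoproj P = z *m orthoproj P].
have dA : definable D A.
  apply: defp_set; apply: defp_exv; apply: defpI.
    by apply: defp_mem => //; exact: (@defv_var _ _ n 0).
  apply: defpI.
    apply: defp_norm_lt (deff_cst _ _).
    by apply: defvB (defv_cst _ _); exact: (@defv_var _ _ n 0).
  apply: defp_eqvec; apply: defv_mulmx; first exact: (@defv_var _ _ n 0).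
  exact: (@defv_var _ _ n n).
have r20 : 0 < r1 / (16 * proj_bound n) by rewrite divr_gt0 // mulr_gt0.
have [a [s [s0 [ay [aA|naA]]]]] := definable_dichotomy y dA r20; last first.
  have {}ay : proj_bound n * `|a - y| < r1 / 16.
    have := ay a; rewrite subrr normr0 => /(_ s0).
    rewrite !ltr_pdivlMr ?mulr_gt0 // => h.
    by rewrite (_ : _ * 16 = `|a - y| * (16 * proj_bound n)) //; ring.
  have ap : `|a *m orthoproj P - y *m orthoproj P| < r1 / 16.
    by rewrite -mulmxBl; apply: le_lt_trans ay; exact: orthoproj_le.
  have [x' /closure_norm Yx' [x'a x'y]] := sh _ (orthoproj_mem P a) (ltW ap).
  have [|x Xx xx'] := Yx' (Num.min (r1 / 2) (s / proj_bound n)).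
    by rewrite lt_min !divr_gt0.
  move: xx'; rewrite lt_min => /andP[xr]; rewrite ltr_pdivlMr // => xs.
  exfalso; apply: (naA (a + (x - x') *m orthoproj P)).
    by rewrite addrAC subrr add0r; have := orthoproj_le P (x - x'); lra.
  exists x; split=> //; split.
    by have := ler_normD (x - x') (x' - y); rewrite addrA subrK; lra.
  rewrite mulmxDl -mulmxA orthoproj_idem -x'a mulmxBl.
  by rewrite addrC subrK.
have [|x [Xx [xy xa]]] := aA a; first by rewrite subrr normr0.
have xr1 : 0 < r1 - `|x - y| by rewrite subr_gt0.
exists x; split=> //; first exact: lt_le_trans r1q.
exists (Num.min (r1 - `|x - y|) (s / proj_bound n)); first by rewrite lt_min xr1 divr_gt0.
move=> z; rewrite lt_min => /andP[zr]; rewrite ltr_pdivlMr // => zs Yz.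
have [|x2 [Xx2 [x2y x2a]]] := aA (a + (z - x) *m orthoproj P).
  by rewrite addrAC subrr add0r; have := orthoproj_le P (z - x); lra.
have <- // : x2 = z.
apply: inj => //; first exact: subset_closure.
  by have := ler_normD (z - x) (x - y); rewrite addrA subrK; lra.
by rewrite x2a mulmxDl -mulmxA orthoproj_idem -xa mulmxBl addrC subrK.
Qed.

Lemma reg_of_open_part n (X : set 'rV[R]_n) x (s : R) :
  X x -> reg (closure X) x -> 0 < s -> (forall z, `|z - x| < s -> closure X z -> X z) ->
  reg X x.
Proof.
move=> Xx [_ [U [k [oU Ux Uk]]]] s0 sX; split=> //.
have oB : open (ball x s) by exact: ball_open.
exists (U `&` ball x s), k; split; [exact: openI|split=> //; exact: ballxx|].
have -> : X `&` (U `&` ball x s) = (closure X `&` U) `&` ball x s.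
  apply/seteqP; split=> z [].
    by move=> Xz [Uz Bz]; split=> //; split=> //; exact: subset_closure.
  move=> [Yz Uz] Bz; split=> //; apply: sX => //.
  by move: Bz; rewrite -ball_normE /ball_ /= distrC.
exact: submanifold_restrict.
Qed.

Lemma set_dim_ge n k (A M : set 'rV[R]_n) :
  M !=set0 -> C1_submanifold k M -> M `<=` A -> (k <= set_dim A)%N.
Proof.
move=> M0 Mk MA; have [x Mx] := M0.
have kn : (k < n.+1)%N by have [kn _] := Mk x Mx.
rewrite /set_dim; apply: (leq_trans _ (leq_bigmax_cond (Ordinal kn) _)) => //=.
by apply/asboolP; exists M.
Qed.

Lemma set_dim_wit n (A : set 'rV[R]_n) : (0 < set_dim A)%N ->
  exists M, [/\ M !=set0, C1_submanifold (set_dim A) M & M `<=` A].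
Proof.
pose P (k : 'I_n.+1) := `[< exists M, [/\ M !=set0, C1_submanifold k M & M `<=` A] >].
move=> d0; have P0 : (0 < #|P|)%N.
  apply/card_gt0P; have [i Pi|P0] := pickP P; first by exists i.
  by move: d0; rewrite /set_dim big_pred0.
have [i Pi iE] := eq_bigmax_cond (fun i : 'I_n.+1 => i : nat) P0.
have -> : set_dim A = i by exact: iE.
by move/asboolP: Pi.
Qed.

(** A neighbourhood of [x] in [X] is itself a submanifold, which contains a
    submanifold of dimension at least [d] and is one of those whose dimension
    is at most [d]. *)
Lemma tangent_dim n d (X : set 'rV[R]_n) x : (0 < d)%N -> is_dim_at X x d -> reg X x ->
  \dim (tangent_space X x) = d.
Proof.
move=> d0 [[V [oV Vx dV]] dle] rx; have [_ [U [oU Ux Uk]]] := reg_tangent rx.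
have Xx : X x by case: rx.
apply/eqP; rewrite eqn_leq; apply/andP; split.
  rewrite -dV; apply: (@set_dim_ge _ _ _ (X `&` U `&` V)); first by exists x.
    exact: submanifold_restrict.
  by move=> z [[]].
have dU := dle U oU Ux; apply: leq_trans dU _.
have [M [[z Mz] Mk MX]] := set_dim_wit (leq_trans d0 (dle U oU Ux)).
exact: submanifold_dim_le Mk Uk Mz MX.
Qed.

End RegularPoints.

(** * Limits of tangent spaces *)

Section NashLimits.
Context {R : realType}.

(** For equalities obtained in the limit. *)
Lemma le0_norm_eq0 (V : normedModType R) (x : V) (C : R) : 0 < C ->
  (forall h, 0 < h < 1 -> `|x| <= C * h) -> x = 0.
Proof.
move=> C0 xC; apply/eqP; rewrite -normr_le0; apply/ler_addgt0Pr => h h0.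
rewrite add0r; pose g := Num.min (h / C) (1 / 2).
have g0 : 0 < g by rewrite lt_min !divr_gt0.
have gh : g <= h / C by rewrite ge_min lexx.
have g1 : g <= 1 / 2 by rewrite ge_min lexx orbT.
apply: (le_trans (xC g _)); first by rewrite g0 /=; lra.
by rewrite mulrC -ler_pdivlMr.
Qed.

(** The Grassmannian is compact: a limit of orthogonal projections is
    symmetric, idempotent and of the same trace. *)
Lemma grassmannian_cluster n d (T : nat -> {vspace 'rV[R]_n}) :
  (forall k, \dim (T k) = d) ->
  exists P : {vspace 'rV[R]_n}, \dim P = d /\ forall h N, 0 < h ->
    exists2 k, (N <= k)%N & `|orthoproj (T k) - orthoproj P| < h.
Proof.
move=> dT; have [Q clQ] := bounded_cluster_mx (fun k => orthoproj_norm_le (T k)).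
have sym : Q^T = Q.
  apply/subr0_eq/(@le0_norm_eq0 _ _ 2) => // h /andP[h0 _]; have [k _ kh] := clQ h 0%N h0.
  have -> : Q^T - Q = - (orthoproj (T k) - Q)^T + (orthoproj (T k) - Q).
    by rewrite linearB /= orthoproj_sym; apply/matrixP => i j; rewrite !mxE; ring.
  apply: le_trans (ler_normD _ _) _; rewrite normrN.
  have : `|(orthoproj (T k) - Q)^T| <= `|orthoproj (T k) - Q|.
    by apply: mx_norm_le => // i j; rewrite mxE; exact: mx_entry_le.
  lra.
have idem : Q *m Q = Q.
  have C0 : 0 < n%:R * `|Q| + n%:R + 1 by rewrite ltr_wpDl // addr_ge0 // mulr_ge0.
  apply/subr0_eq/(le0_norm_eq0 C0) => // h /andP[h0 _]; have [k _ kh] := clQ h 0%N h0.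
  set O := orthoproj (T k) in kh *.
  have -> : Q *m Q - Q = Q *m (Q - O) + (Q - O) *m O + (O - Q).
    rewrite mulmxBr mulmxBl orthoproj_idem.
    by apply/matrixP => i j; rewrite ![in RHS]mxE ![in LHS]mxE; ring.
  have h1 := norm_mulmx_le Q (Q - O); have h2 := norm_mulmx_le (Q - O) O.
  rewrite distrC in kh; have O1 : `|O| <= 1 := orthoproj_norm_le (T k).
  have h3 : n%:R * `|Q - O| * `|O| <= n%:R * `|Q - O| * 1 by rewrite ler_wpM2l // mulr_ge0.
  have h4 : n%:R * `|Q| * `|Q - O| <= n%:R * `|Q| * h by rewrite ler_wpM2l ?mulr_ge0 // ltW.
  have h5 : n%:R * `|Q - O| <= n%:R * h by rewrite ler_wpM2l // ltW.
  apply: le_trans (ler_normD _ _) _; rewrite [`|O - Q|]distrC.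
  have := ler_normD (Q *m (Q - O)) ((Q - O) *m O).
  by rewrite !mulrDl mul1r; lra.
have trQ : \tr Q = d%:R.
  have C0 : 0 < n%:R + 1 :> R by rewrite ltr_wpDl.
  apply/subr0_eq/(@le0_norm_eq0 R^o _ _ C0) => // h /andP[h0 _]; have [k _ kh] := clQ h 0%N h0.
  rewrite -(dT k) -orthoproj_trace -linearB /=; rewrite distrC in kh.
  rewrite /mxtrace (le_trans (ler_norm_sum _ _ _)) //.
  apply: (@le_trans _ _ (\sum_(i < n) h)); last first.
    by rewrite sumr_const card_ord -[leLHS]mulr_natl mulrDl mul1r lerDl ltW.
  by apply: ler_sum => i _; apply: le_trans (mx_entry_le _ _ _) (ltW kh).
exists (fixspace Q); split; last by move=> h N h0; rewrite orthoproj_fixspace //; exact: clQ.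
by apply/eqP; rewrite -(eqr_nat R) -fixspace_dim // trQ.
Qed.

Lemma normalizeZ n (t : R) (u : 'rV[R]_n) : 0 < t -> normalize (t *: u) = normalize u.
Proof.
move=> t0; rewrite /normalize.
have -> : enorm (t *: u) = t * enorm u.
  rewrite /enorm -[t in RHS](gtr0_norm t0) -sqrtr_sqr -sqrtrM ?sqr_ge0 // mulr_sumr.
  by congr Num.sqrt; apply: eq_bigr => i _; rewrite mxE exprMn.
by rewrite scalerA invfM mulrAC mulVf ?mul1r // gt_eqF.
Qed.

Lemma enorm_gt0 n (u : 'rV[R]_n) : u <> 0 -> 0 < enorm u.
Proof.
move=> u0; rewrite sqrtr_gt0 lt_neqAle sumr_ge0 ?andbT => [|i _]; last exact: sqr_ge0.
rewrite eq_sym psumr_eq0 => [|i _]; last exact: sqr_ge0.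
apply/negP => /allP uz; apply: u0; apply/rowP => i; rewrite mxE.
by have := uz i; rewrite mem_index_enum sqrf_eq0 => /(_ isT)/eqP.
Qed.

Lemma normalize_cvg n (u : nat -> 'rV[R]_n) v : v <> 0 -> u @ \oo --> v ->
  (fun k => normalize (u k)) @ \oo --> normalize v.
Proof.
move=> v0 uv; apply: cvgZ => //; apply: cvgV; first by rewrite gt_eqF // enorm_gt0.
apply: (@cvg_comp _ _ _ (fun k => \sum_i u k ord0 i ^+ 2) (@Num.sqrt R));
  last exact: sqrt_continuous.
apply: cvg_big => [|i _]; first exact: add_continuous.
have ui : (fun k => u k ord0 i) @ \oo --> v ord0 i.
  exact: (cvg_comp _ _ uv (@coord_continuous _ _ _ ord0 i v)).
exact: (cvgM ui ui).
Qed.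

Lemma nash_cluster n d (X : set 'rV[R]_n) (v : 'rV[R]_n) (t : nat -> R) (u : nat -> 'rV[R]_n) :
  v <> 0 -> (forall k, 0 < t k < k.+1%:R^-1) ->
  (forall k, `|u k - v| < k.+1%:R^-1 /\ u k <> 0) ->
  (forall k, reg X (t k *: u k) /\ \dim (tangent_space X (t k *: u k)) = d) ->
  exists2 P, nash_fiber d X v P & forall h N, 0 < h ->
    exists2 k, (N <= k)%N & `|orthoproj (tangent_space X (t k *: u k)) - orthoproj P| < h.
Proof.
move=> v0 tk uk Xk.
have [P [dP clP]] := grassmannian_cluster (fun k => (Xk k).2).
exists P => //; split=> //.
have sub j : {k | (j <= k)%N /\
    `|orthoproj (tangent_space X (t k *: u k)) - orthoproj P| < j.+1%:R^-1}.
  apply: cid; have [|k jk kP] := clP j.+1%:R^-1 j; first by rewrite invr_gt0 ltr0n.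
  by exists k.
pose f j := sval (sub j).
have fj j : (j <= f j)%N by rewrite /f; case: (sub j) => k [].
have fP j : `|orthoproj (tangent_space X (t (f j) *: u (f j))) - orthoproj P| < j.+1%:R^-1.
  by rewrite /f; case: (sub j) => k [].
have inv_le j : (f j).+1%:R^-1 <= j.+1%:R^-1 :> R.
  by rewrite lef_pV2 ?posrE ?ltr0n // ler_nat ltnS.
have t0 k : 0 < t k by have /andP[] := tk k.
have uv : (fun j => u (f j)) @ \oo --> v.
  apply/cvg_norm => h h0; have [N Nh] := invS_cvg0 h0; exists N => k /Nh; apply: lt_trans.
  by apply: lt_le_trans (inv_le k); have [] := uk (f k).
exists (fun j => t (f j) *: u (f j)); split.
- move=> j; split; first by have [] := Xk (f j).
  have [_ un0] := uk (f j) => /eqP; rewrite scaler_eq0 gt_eqF //= => /eqP.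
  exact: un0.
- have tl : (fun j => t (f j)) @ \oo --> (0 : R).
    apply/cvg_norm => h h0; have [N Nh] := invS_cvg0 h0; exists N => k /Nh; apply: lt_trans.
    rewrite subr0 gtr0_norm //; apply: lt_le_trans (inv_le k).
    by have /andP[] := tk (f k).
  by rewrite -[0](scale0r v); apply: cvgZ.
- under eq_fun do rewrite normalizeZ //.
  exact: normalize_cvg.
- apply/cvg_norm => h h0; have [N Nh] := invS_cvg0 h0; exists N => k /Nh; apply: lt_trans.
  exact: fP.
Qed.

Lemma card_ge_two (T : Type) (A : set T) (a b : T) : A a -> A b -> a <> b -> (`I_2 #<= A)%card.
Proof.
move=> Aa Ab ab; pose f (i : nat) := if i is 0%N then a else b.
have fI : {in `I_2 &, injective f}.
  by move=> [|[|i]] [|[|j]]; rewrite ?inE //= => _ _ h; exfalso; apply: ab.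
have [g] : $|{injfun `I_2 >-> A}| by apply/injfunPex; exists f => // -[|i] _.
exact: inj_card_le g.
Qed.

End NashLimits.

(** * The tangent cone along a ray with a single limit of tangent spaces *)

Section ConeRay.
Context {R : realType} (D : ominimal_structure R) (n d : nat) (X : set 'rV[R]_n) (v : 'rV[R]_n).
Hypothesis hX : definable D X.
Hypothesis hd : (0 < d)%N.
Hypothesis hpure : pure_dim_at X 0 d.
Hypothesis v0 : v <> 0.
Hypothesis vC : tvec X 0 v.
Hypothesis vS : ~ tvec (sing (closure X)) 0 v.

Let Y : set 'rV[R]_n := closure X.

Let XY x : X x -> Y x.
Proof. by move=> Xx; exact: subset_closure. Qed.

Let vpos : 0 < `|v|.
Proof. by rewrite normr_gt0; apply/eqP. Qed.

Lemma cone_regular : exists2 h : R, 0 < h & forall t u, 0 < t < h -> `|u - v| < h ->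
  closure X (t *: u) -> reg (closure X) (t *: u).
Proof.
move: vS => /existsNP[h /not_implyP[h0 /forallNP hS]]; exists h => // t u th uv Ytu.
apply: contrapT => nr; apply: (hS t); exists u; rewrite add0r.
by split; [exact: th|exact: uv|split; [exact: Ytu|exact: nr]].
Qed.

Lemma cone_dim : exists2 h : R, 0 < h & forall t u, 0 < t < h -> `|u - v| < h ->
  reg X (t *: u) -> \dim (tangent_space X (t *: u)) = d.
Proof.
have [_ [U [oU U0 Ud]]] := hpure; have [r r0 rU] := open_norm_ball oU U0.
have v1 : 0 < `|v| + 1 by rewrite ltr_wpDl.
exists (Num.min 1 (r / (`|v| + 1))); first by rewrite lt_min ltr01 divr_gt0.
move=> t u /andP[t0]; rewrite !lt_min => /andP[_ tr] /andP[u1 _] rX.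
apply: tangent_dim => //; apply: Ud; split; first by case: rX.
apply: rU; rewrite subr0 normrZ gtr0_norm //.
move: tr; rewrite ltr_pdivlMr //; apply: le_lt_trans; rewrite ler_pM2l //.
by have := ler_normD (u - v) v; rewrite subrK; lra.
Qed.

(** Regularity, dimension and openness in [Y] are obtained at the same points,
    so that one approximation serves for all of them. *)
Lemma cone_good : exists2 h : R, 0 < h & forall t u, 0 < t < h -> `|u - v| < h ->
  closure X (t *: u) -> forall q, 0 < q -> exists u', [/\ `|u' - u| < q, reg X (t *: u'),
    \dim (tangent_space X (t *: u')) = d & exists2 s : R, 0 < s &
      forall z, `|z - t *: u'| < s -> closure X z -> X z].
Proof.
have [h1 h10 rP] := cone_regular; have [h2 h20 dP] := cone_dim.
have h0 : 0 < Num.min h1 h2 by rewrite lt_min h10.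
exists (Num.min h1 h2) => // t u /andP[t0 th] uv Ytu q q0.
have [th1 th2] : t < h1 /\ t < h2 by apply/andP; rewrite -lt_min.
pose q' := Num.min q (Num.min h1 h2 - `|u - v|).
have q'0 : 0 < q' by rewrite lt_min q0 subr_gt0.
have uh1 : `|u - v| < h1 by move: uv; rewrite lt_min => /andP[].
have rtu : reg Y (t *: u) by apply: rP => //; rewrite t0.
have [x [Xx xtu [s s0 sX]]] := regular_closure_approx hX rtu (mulr_gt0 t0 q'0).
have xE : t *: (t^-1 *: x) = x by rewrite scaler_posK.
have uu : `|t^-1 *: x - u| < q'.
  rewrite -(ltr_pM2l t0); apply: le_lt_trans xtu.
  by rewrite -{1}(gtr0_norm t0) -normrZ scalerBr xE.
move: (uu); rewrite lt_min => /andP[uq uh].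
have uv' : `|t^-1 *: x - v| < Num.min h1 h2.
  by have := ler_normD (t^-1 *: x - u) (u - v); rewrite addrA subrK; lra.
have [uv1 uv2] : `|t^-1 *: x - v| < h1 /\ `|t^-1 *: x - v| < h2 by apply/andP; rewrite -lt_min.
have rx : reg X x.
  have Yx : Y x := XY Xx; rewrite -xE in Yx.
  apply: (@reg_of_open_part _ n X x s Xx) s0 sX; rewrite -xE.
  by apply: rP uv1 Yx; rewrite t0.
exists (t^-1 *: x); rewrite xE; split=> //; last by exists s.
by rewrite -xE; apply: dP; rewrite ?t0 // xE.
Qed.

Lemma nash_fiber_nonempty : exists P, nash_fiber d X v P.
Proof.
have [h h0 gP] := cone_good.
have ch k : exists tu : R * 'rV[R]_n, [/\ 0 < tu.1 < k.+1%:R^-1,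
    `|tu.2 - v| < k.+1%:R^-1 /\ tu.2 <> 0 &
    reg X (tu.1 *: tu.2) /\ \dim (tangent_space X (tu.1 *: tu.2)) = d].
  have k0 : 0 < k.+1%:R^-1 :> R by rewrite invr_gt0 ltr0n.
  pose g := Num.min h (Num.min k.+1%:R^-1 `|v|).
  have g0 : 0 < g by rewrite !lt_min h0 k0.
  have [gh gk gv] : [/\ g <= h, g <= k.+1%:R^-1 & g <= `|v|].
    by rewrite /g; split; rewrite !ge_min lexx ?orbT.
  have [|t [u [/andP[t0 tg] ug]]] := vC (h := g / 2); first by rewrite divr_gt0.
  rewrite add0r => Xtu.
  have [|||u' [uu rX dT _]] := gP t u _ _ (XY Xtu) (g / 2); rewrite ?divr_gt0 //.
  - by rewrite t0 /=; lra.
  - lra.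
  have uv : `|u' - v| < g by have := ler_normD (u' - u) (u - v); rewrite addrA subrK; lra.
  exists (t, u'); split=> //=; first by rewrite t0 /= (lt_le_trans _ gk) //; lra.
  split; first exact: lt_le_trans gk.
  by move=> u0; move: uv; rewrite u0 sub0r normrN; lra.
have [f fP] := choice ch.
have [|||P NP _] :=
  @nash_cluster R n d X v (fun k => (f k).1) (fun k => (f k).2) v0.
- by move=> k; have [] := fP k.
- by move=> k; have [] := fP k.
- by move=> k; have [] := fP k.
by exists P.
Qed.

Variable P : {vspace 'rV[R]_n}.
Hypothesis PN : forall P', nash_fiber d X v P' -> P' = P.

(** Otherwise tangent spaces at points converging to the ray, and far from [P],
    would accumulate at another element of the Nash fiber. *)
Lemma tangent_near e : 0 < e -> exists2 h : R, 0 < h & forall t u, 0 < t < h -> `|u - v| < h ->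
  reg X (t *: u) -> `|orthoproj (tangent_space X (t *: u)) - orthoproj P| <= e.
Proof.
move=> e0; apply: contrapT => no; have [h h0 dP] := cone_dim.
have ch k : exists tu : R * 'rV[R]_n, [/\ 0 < tu.1 < k.+1%:R^-1,
    `|tu.2 - v| < k.+1%:R^-1 /\ tu.2 <> 0,
    reg X (tu.1 *: tu.2) /\ \dim (tangent_space X (tu.1 *: tu.2)) = d &
    e < `|orthoproj (tangent_space X (tu.1 *: tu.2)) - orthoproj P|].
  have k0 : 0 < k.+1%:R^-1 :> R by rewrite invr_gt0 ltr0n.
  pose g := Num.min h (Num.min k.+1%:R^-1 `|v|).
  have g0 : 0 < g by rewrite !lt_min h0 k0.
  have [gh gk gv] : [/\ g <= h, g <= k.+1%:R^-1 & g <= `|v|].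
    by rewrite /g; split; rewrite !ge_min lexx ?orbT.
  apply: contrapT => nk; apply: no; exists g => // t u /andP[t0 tg] ug rX.
  rewrite leNgt; apply/negP => eT; apply: nk; exists (t, u); split=> //=.
  - by rewrite t0 (lt_le_trans tg).
  - split; first exact: lt_le_trans gk.
    by move=> u0; move: ug; rewrite u0 sub0r normrN; lra.
  - by split=> //; apply: dP => //; rewrite ?t0 ?(lt_le_trans tg) // (lt_le_trans ug).
have [f fP] := choice ch.
have [|||P' /PN -> /(_ e 0%N e0)[k _]] :=
  @nash_cluster R n d X v (fun k => (f k).1) (fun k => (f k).2) v0.
- by move=> k; have [] := fP k.
- by move=> k; have [] := fP k.
- by move=> k; have [] := fP k.
by have [_ _ _ eT] := fP k; move=> /(lt_trans eT); rewrite ltxx.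
Qed.

(** Arbitrarily close to a point of [Y] near the ray there are points at which
    [X] is open in [Y], so that their tangent space is close to [P]; by
    continuity it is also close to that of the given point. *)
Lemma closure_tangent_near e : 0 < e -> exists2 h : R, 0 < h &
  forall t u, 0 < t < h -> `|u - v| < h ->
  closure X (t *: u) -> reg (closure X) (t *: u) /\
  (forall p, p \in P -> exists2 w, tvec (closure X) (t *: u) w & `|w - p| <= e * `|p|) /\
  (forall w, tvec (closure X) (t *: u) w -> `|w *m oproj P| <= e * `|w|).
Proof.
(* Half of the error comes from the tangent space of [X], and half from its
   transport to the given point. *)
move=> e0; pose e1 := e / (2 * proj_bound n).
have B1 : 1 <= proj_bound n :> R := proj_bound_ge1 n.
have B0 : 0 < proj_bound n :> R := proj_bound_gt0 n.
have e10 : 0 < e1 by rewrite divr_gt0 // mulr_gt0.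
have Be1 : proj_bound n * e1 = e / 2 by rewrite /e1; field; rewrite gt_eqF.
pose g := Num.min 1 e1.
have g0 : 0 < g by rewrite lt_min ltr01.
have [g1 ge1] : g <= 1 /\ g <= e1 by rewrite /g; split; rewrite ge_min lexx ?orbT.
have [h1 h10 rP] := cone_regular; have [h2 h20 gP] := cone_good.
have [h3 h30 nP] := tangent_near e10.
exists (Num.min h1 (Num.min h2 h3)); first by rewrite !lt_min h10 h20.
move=> t u /andP[t0]; rewrite !lt_min => /and3P[th1 th2 th3] /and3P[uh1 uh2 uh3] Ytu.
have rtu : reg Y (t *: u) by apply: rP; rewrite ?t0.
split=> //; have [_ [U [oU Utu Uk]]] := reg_tangent rtu.
have YU : (Y `&` U) (t *: u) by [].
have [r r0 [_ tra]] := chart_flat (Uk _ YU) YU g0.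
have [q q0 qU] := open_norm_ball oU Utu.
pose q' := Num.min (Num.min r q / t) (h3 - `|u - v|).
have q'0 : 0 < q' by rewrite lt_min subr_gt0 uh3 andbT divr_gt0 // lt_min r0.
have th2' : 0 < t < h2 by rewrite t0.
have [u' [uu rX dT [s s0 sX]]] := gP t u th2' uh2 Ytu q' q'0.
move: uu; rewrite lt_min ltr_pdivlMr // => /andP[uu uh].
have {}uu : `|t *: u' - t *: u| < Num.min r q by rewrite -scalerBr normrZ gtr0_norm // mulrC.
have [ur uq] : `|t *: u' - t *: u| < r /\ `|t *: u' - t *: u| < q by apply/andP; rewrite -lt_min.
have uv' : `|u' - v| < h3.
  by have := ler_normD (u' - u) (u - v); rewrite addrA subrK; lra.
have Xu' : X (t *: u') by case: rX.
have YUu' : (Y `&` U) (t *: u') by split; [exact: XY|exact: qU].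
have TP := nP t u' (ltac:(by rewrite t0 th3)) uv' rX.
have [memT _] := reg_tangent rX; set T := tangent_space X (t *: u') in TP memT dT.
have nB : 2 * n%:R <= proj_bound n :> R by rewrite /proj_bound lerDl.
have tvT w : tvec (Y `&` U) (t *: u') w <-> w \in T.
  rewrite memT; split; first by apply: tvec_local s0 _ => z zs [Yz _]; exact: sX.
  have [p p0 pU] := open_norm_ball oU YUu'.2.
  by apply: tvec_local p0 _ => z /pU Uz Xz; split=> //; exact: XY.
have TPle (x : 'rV[R]_n) : `|x *m (orthoproj T - orthoproj P)| <= n%:R * (e1 * `|x|).
  apply: le_trans (norm_mulmx_le _ _) _; rewrite -mulrA; apply: ler_wpM2l => //.
  by apply: ler_wpM2r.
have [tra1 tra2] := tra _ ur YUu'.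
split=> [p pP|w tw].
  have [|w tw wp] := tra2 (p *m orthoproj T); first by apply/tvT; exact: orthoproj_mem.
  exists w; first by apply: tvec_sub tw => z [].
  have h4 := TPle p; rewrite mulmxBr (orthoproj_id pP) in h4.
  have h5 : g * `|p *m orthoproj T| <= e1 * (proj_bound n * `|p|).
    by apply: ler_pM => //; [exact: ltW|exact: orthoproj_le].
  have h6 : n%:R * (e1 * `|p|) <= proj_bound n * (e1 * `|p|).
    apply: ler_wpM2r; first by rewrite mulr_ge0 // ltW.
    by have := ler0n R n; lra.
  have h7 : proj_bound n * (e1 * `|p|) = e / 2 * `|p| by rewrite mulrA Be1.
  have := ler_normD (w - p *m orthoproj T) (p *m orthoproj T - p).
  rewrite addrA subrK => /le_trans; apply; rewrite distrC in wp; lra.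
have tw' : tvec (Y `&` U) (t *: u) w.
  by apply: tvec_local q0 _ tw => z /qU Uz Yz; split.
have [w' /tvT w'T w'w] := tra1 w tw'.
have h4 := TPle w'; rewrite mulmxBr (orthoproj_id w'T) -{1}[w']mulmx1 -mulmxBr in h4.
have gw : g * `|w| <= 1 * `|w| by rewrite ler_wpM2r.
have w'2 : `|w'| <= 2 * `|w| by have := ler_normD (w' - w) w; rewrite subrK; lra.
have h5 : n%:R * (e1 * `|w'|) <= n%:R * (e1 * (2 * `|w|)).
  by rewrite ler_wpM2l // ler_wpM2l // ltW.
have h6 : 2 * n%:R * (e1 * `|w|) <= proj_bound n * (e1 * `|w|).
  by apply: ler_wpM2r => //; rewrite mulr_ge0 // ltW.
have h7 : proj_bound n * (e1 * `|w|) = e / 2 * `|w| by rewrite mulrA Be1.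
have h8 := oproj_le P (w - w').
have h9 : proj_bound n * `|w - w'| <= proj_bound n * (e1 * `|w|).
  rewrite ler_pM2l // distrC; apply: le_trans w'w _.
  by rewrite ler_wpM2r.
have := ler_normD (w' *m oproj P) ((w - w') *m oproj P).
rewrite -mulmxDl subrKC => /le_trans; apply; lra.
Qed.

(** A short secant of [Y] is close to a tangent vector, hence to [P], and cannot
    be orthogonal to [P]. *)
Lemma fibre_isolated : exists2 h : R, 0 < h & forall t u, 0 < t < h -> `|u - v| < h ->
  closure X (t *: u) -> exists2 s : R, 0 < s & forall u', closure X (t *: u') -> `|u' - u| < s ->
    u' *m orthoproj P = u *m orthoproj P -> u' = u.
Proof.
have e0 : 0 < 1 / 4 :> R by rewrite divr_gt0.
have [h h0 hP] := closure_tangent_near e0; exists h => // t u th uv Ytu.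
have [rtu [_ E2]] := hP t u th uv Ytu; have /andP[t0 _] := th.
have [_ [U [oU Utu Uk]]] := reg_tangent rtu.
have YU : (Y `&` U) (t *: u) by [].
have B1 : 1 <= proj_bound n :> R := proj_bound_ge1 n.
have B0 : 0 < proj_bound n :> R := proj_bound_gt0 n.
pose g : R := (4 * proj_bound n)^-1.
have g0 : 0 < g by rewrite invr_gt0 mulr_gt0.
have Bg : proj_bound n * g = 1 / 4 by rewrite /g; field; rewrite gt_eqF.
have g4 : g <= 1 / 4 by rewrite -Bg ler_peMl // ltW.
have [r r0 [sec _]] := chart_flat (Uk _ YU) YU g0.
have [q q0 qU] := open_norm_ball oU Utu.
exists (Num.min r q / t); first by rewrite divr_gt0 // lt_min r0.
move=> u' Ytu'; rewrite ltr_pdivlMr // mulrC -{1}(gtr0_norm t0) -normrZ scalerBr.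
rewrite lt_min => /andP[ur uq] uE.
have YU' : (Y `&` U) (t *: u') by split=> //; exact: qU.
have [|w tw wd] := sec (t *: u) (t *: u') _ ur YU YU'; first by rewrite subrr normr0.
have {}tw : tvec Y (t *: u) w by apply: tvec_sub tw => ? [].
set z := t *: u' - t *: u in wd.
have zP : z *m orthoproj P = 0 by rewrite /z -scalerBr -scalemxAl mulmxBl uE subrr scaler0.
have zQ : z *m oproj P = z by rewrite [RHS](proj_split P) zP add0r.
have b1 := E2 w tw; have b2 := oproj_le P (z - w).
have b3 : proj_bound n * `|z - w| <= proj_bound n * (g * `|z|) by rewrite ler_pM2l.
have b4 : proj_bound n * (g * `|z|) = 1 / 4 * `|z| by rewrite mulrA Bg.
have b5 : g * `|z| <= 1 / 4 * `|z| by rewrite ler_wpM2r.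
have b6 : `|w| <= `|z - w| + `|z|.
  by have := ler_normD (w - z) z; rewrite subrK [`|w - z|]distrC.
have b7 : `|z| <= `|w *m oproj P| + `|(z - w) *m oproj P|.
  by rewrite -{1}zQ -{1}[z](subrKC w) mulmxDl; exact: ler_normD.
have : `|z| <= 0 by have := normr_ge0 z; lra.
rewrite normr_le0 /z -scalerBr scaler_eq0 gt_eqF //= subr_eq0.
by move/eqP.
Qed.

Lemma tvec_dilate t u w : 0 < t -> tvec Y (t *: u) w -> tvec [set x | Y (t *: x)] u w.
Proof.
move=> t0 tv h h0; have [|s [z [/andP[s0]]]] := tv (Num.min h (h * t)).
  by rewrite lt_min h0 mulr_gt0.
rewrite !lt_min => /andP[_ sh] /andP[zh _] Yz.
exists (s / t), z; split; [by rewrite divr_gt0 //= ltr_pdivrMr|exact: zh|].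
by rewrite /= scalerDr scalerA mulrCA divff ?mulr1 // gt_eqF.
Qed.

Let cY : closed Y. Proof. exact: closed_closure. Qed.

Lemma closed_dilate t : closed [set x | Y (t *: x)].
Proof.
apply: preimage_closed cY => x _; exact: scaler_continuous.
Qed.

Lemma rescaled_sheet M : 1 <= M -> exists2 r : R, 0 < r & forall t x a, 0 < t < r ->
  Y (t *: x) -> `|x - v| <= r / 2 -> a \in P -> `|a - x *m orthoproj P| <= r / 16 ->
  exists x', [/\ Y (t *: x'), x' *m orthoproj P = a, `|x' - x| <= 4 * `|a - x *m orthoproj P| &
     M * `|(x' - x) *m oproj P| <= `|a - x *m orthoproj P|].
Proof.
move=> M1; have B1 : 1 <= proj_bound n :> R := proj_bound_ge1 n.
have M0 : 0 < M by exact: lt_le_trans ltr01 M1.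
have C0 : 0 < 8 * proj_bound n * M by rewrite !mulr_gt0 // proj_bound_gt0.
pose e := (8 * proj_bound n * M)^-1.
have e0 : 0 < e by rewrite invr_gt0.
have [h h0 hP] := closure_tangent_near e0; exists h => // t x a th Ytx xv aP ax.
have /andP[t0 _] := th.
have eM : 8 * proj_bound n * M * e <= 1 by rewrite /e divff // gt_eqF.
have tY y : Y (t *: y) -> `|y - v| < h -> forall p, p \in P ->
    exists2 w, tvec [set x | Y (t *: x)] y w & `|w - p| <= e * `|p|.
  move=> Yty yv p pP; have [_ [/(_ p pP)[w tw wp] _]] := hP t y th yv Yty.
  by exists w; [exact: tvec_dilate|exact: wp].
exact: (@sheet _ n [set x | Y (t *: x)] P v h e M (@closed_dilate t) h0 M1 (ltW e0) eM tY).
Qed.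

(** The tangent cone inherits the sheets of the dilations of [Y], by
    compactness. *)
Lemma cone_sheet M : 1 <= M -> exists2 r : R, 0 < r & forall w a, tvec X 0 w ->
  `|w - v| < r / 2 -> a \in P -> `|a - w *m orthoproj P| < r / 16 ->
  exists c, [/\ tvec X 0 c, c *m orthoproj P = a, `|c - w| <= 4 * `|a - w *m orthoproj P| &
     M * `|(c - w) *m oproj P| <= `|a - w *m orthoproj P|].
Proof.
move=> M1; have [r r0 rP] := rescaled_sheet M1; exists r => // w a tw wv aP aw.
have M0 : 0 < M by exact: lt_le_trans ltr01 M1.
have B0 : 0 < proj_bound n :> R := proj_bound_gt0 n.
have B1 : 1 <= proj_bound n :> R := proj_bound_ge1 n.
set A := `|a - w *m orthoproj P| in aw *.
have A0 : 0 <= A by rewrite normr_ge0.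
have ch k : exists z : R * ('rV[R]_n * 'rV[R]_n), [/\ 0 < z.1 < k.+1%:R^-1,
    `|z.2.1 - w| < k.+1%:R^-1, Y (z.1 *: z.2.2) &
    [/\ z.2.2 *m orthoproj P = a, `|z.2.2 - z.2.1| <= 4 * `|a - z.2.1 *m orthoproj P| &
     M * `|(z.2.2 - z.2.1) *m oproj P| <= `|a - z.2.1 *m orthoproj P|]].
  have k0 : 0 < k.+1%:R^-1 :> R by rewrite invr_gt0 ltr0n.
  pose g := Num.min (Num.min r k.+1%:R^-1)
    (Num.min (r / 2 - `|w - v|) ((r / 16 - A) / proj_bound n)).
  have g0 : 0 < g by rewrite !lt_min r0 k0 !subr_gt0 wv divr_gt0 // subr_gt0.
  have [t [u [/andP[t0 tg] ug]]] := tw g g0; rewrite add0r => Xtu.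
  move: tg ug; rewrite !lt_min => /andP[/andP[tr tk] _] /andP[/andP[_ uk] /andP[uw]].
  rewrite ltr_pdivlMr // => uA.
  have ua : `|a - u *m orthoproj P| <= A + proj_bound n * `|u - w|.
    have := ler_normD (a - w *m orthoproj P) (- ((u - w) *m orthoproj P)).
    rewrite normrN mulmxBl opprB addrA subrK -mulmxBl => /le_trans; apply.
    by rewrite lerD2l orthoproj_le.
  have [|||x' [Yx' x'a x'u x'q]] := rP t u a _ (XY Xtu) _ aP.
  - by rewrite t0.
  - by have := ler_normD (u - w) (w - v); rewrite addrA subrK; lra.
  - lra.
  by exists (t, (u, x')); split=> //=; rewrite t0.
have [f fP] := choice ch.
pose t k := (f k).1; pose u k := (f k).2.1; pose x k := (f k).2.2.
have ua k : `|a - u k *m orthoproj P| <= A + proj_bound n * k.+1%:R^-1.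
  have [_ uw _ _] := fP k.
  have := ler_normD (a - w *m orthoproj P) (- ((u k - w) *m orthoproj P)).
  rewrite normrN mulmxBl opprB addrA subrK -mulmxBl => /le_trans; apply.
  rewrite lerD2l; apply: le_trans (orthoproj_le _ _) _.
  by rewrite ler_pM2l // ltW.
have inv1 k : k.+1%:R^-1 <= 1 :> R by rewrite invf_le1 ?ler1n ?ltr0n.
have [k|c cP] := @bounded_cluster R n x (`|w| + 1 + 4 * (A + proj_bound n)).
  have [_ uw _ [_ xu _]] := fP k; rewrite -/(u k) -/(x k) in uw xu.
  have := ler_normD (x k - u k) (u k - w); have := ler_normD (x k - w) w.
  rewrite addrA !subrK; move: (ua k) (inv1 k) uw => u1 i1 uw.
  have : proj_bound n * k.+1%:R^-1 <= proj_bound n * 1 :> R.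
    by apply: ler_wpM2l; [exact: ltW|exact: inv1].
  move: i1 uw u1; move: (k.+1%:R^-1) => z; lra.
exists c.
(* Each property of [c] holds up to an error which tends to 0 along the
   sequence. *)
have close h : 0 < h -> exists k, [/\ k.+1%:R^-1 < h, `|x k - c| < h & `|u k - w| < h].
  move=> h0; have [N Nh] := invS_cvg0 h0; have [k Nk kc] := cP h N h0.
  exists k; split=> //; first exact: Nh.
  by have [_ uw _ _] := fP k; apply: lt_trans uw (Nh k Nk).
have xa k : x k *m orthoproj P = a by have [_ _ _ []] := fP k.
split.
- apply: tvec_closure => h h0; have [k [kh kc _]] := close h h0.
  have [/andP[t0 tk] _ Yx _] := fP k; exists (t k), (x k); rewrite add0r.
  by split; [rewrite t0 (lt_trans tk)|exact: kc|exact: Yx].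
- apply/subr0_eq/(le0_norm_eq0 B0) => h /andP[h0 _]; have [k [_ kc _]] := close h h0.
  rewrite -(xa k) -mulmxBl; apply: le_trans (orthoproj_le _ _) _.
  by rewrite ler_pM2l // distrC ltW.
- apply/ler_addgt0Pr => h h0.
  have C0 : 0 < 2 + 4 * proj_bound n :> R by apply: addr_gt0 => //; apply: mulr_gt0.
  have [k [kh kc uk]] := close (h / (2 + 4 * proj_bound n)) (divr_gt0 h0 C0).
  have [_ _ _ [_ xu _]] := fP k; rewrite -/(u k) -/(x k) in xu.
  have := ler_normD (c - x k) (x k - u k); have := ler_normD (c - u k) (u k - w).
  rewrite !addrA !subrK [`|c - x k|]distrC => n1 n2.
  have := ua k => u1.
  have h1 : (2 + 4 * proj_bound n) * (h / (2 + 4 * proj_bound n)) = h.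
    by rewrite mulrCA divff ?mulr1 // gt_eqF.
  move: kh kc uk h1; move: (h / (2 + 4 * proj_bound n)) => g kh kc uk h1.
  have : proj_bound n * k.+1%:R^-1 <= proj_bound n * g :> R by apply: ler_wpM2l; exact: ltW.
  move: u1; move: (proj_bound n * k.+1%:R^-1) => z; lra.
- apply/ler_addgt0Pr => h h0; pose E := proj_bound n + 2 * M * proj_bound n.
  have E0 : 0 < E by rewrite addr_gt0 // !mulr_gt0.
  have [k [kh kc uk]] := close (h / E) (divr_gt0 h0 E0).
  have [_ _ _ [_ _ xq]] := fP k; rewrite -/(u k) -/(x k) in xq.
  have := ler_normD ((c - x k) *m oproj P) ((x k - u k) *m oproj P).
  have := ler_normD ((c - u k) *m oproj P) ((u k - w) *m oproj P).
  rewrite -!mulmxDl !addrA !subrK => n1 n2.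
  have n3 := oproj_le P (c - x k); have n4 := oproj_le P (u k - w).
  have u1 := ua k.
  have h1 : E * (h / E) = h by rewrite mulrCA divff ?mulr1 // gt_eqF.
  rewrite [`|c - x k|]distrC in n3.
  move: kh kc uk h1; move: (h / E) => g kh kc uk h1.
  have m1 : proj_bound n * k.+1%:R^-1 <= proj_bound n * g :> R by apply: ler_wpM2l; exact: ltW.
  have m2 : proj_bound n * `|x k - c| <= proj_bound n * g by rewrite ler_pM2l // ltW.
  have m3 : proj_bound n * `|u k - w| <= proj_bound n * g by rewrite ler_pM2l // ltW.
  have {}n1 : `|(c - w) *m oproj P| <= `|(x k - u k) *m oproj P| + 2 * (proj_bound n * g) by lra.
  have := ler_wpM2l (ltW M0) n1; move: u1 m1 h1; rewrite /E.
  move: (proj_bound n * k.+1%:R^-1) => z; lra.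
Qed.

(** Follow the sheet of the tangent cone through [v] in the direction [p]: its
    slope is at most [1 / M], for any [M], on a ball that depends on [M]. *)
Lemma plane_in_double_cone p : p \in P -> tvec [set w | tvec X 0 w] v p.
Proof.
move=> pP h h0; pose M := `|p| / h + 1.
have M1 : 1 <= M by rewrite lerDr divr_ge0 // ltW.
have Mh : `|p| < M * h by rewrite mulrDl mul1r divfK ?gt_eqF // ltrDl.
have M0 : 0 < M by exact: lt_le_trans ltr01 M1.
have [r r0 rP] := cone_sheet M1.
have p1 : 0 < `|p| + 1 by rewrite ltr_wpDl.
pose s := Num.min h (r / (16 * (`|p| + 1))) / 2.
have s0 : 0 < s by rewrite divr_gt0 // lt_min h0 divr_gt0 // mulr_gt0.
have : s < Num.min h (r / (16 * (`|p| + 1))) by move: s0; rewrite /s; lra.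
rewrite lt_min ltr_pdivlMr ?mulr_gt0 // => /andP[sh sr].
have sp : `|v *m orthoproj P + s *: p - v *m orthoproj P| = s * `|p|.
  by rewrite addrAC subrr add0r normrZ gtr0_norm.
have [|||c [tc cP _ cQ]] := rP v (v *m orthoproj P + s *: p) vC.
- by rewrite subrr normr0 divr_gt0.
- by rewrite rpredD ?rpredZ // orthoproj_mem.
- by rewrite sp; move: sr; rewrite mulrCA mulrDr mulr1; lra.
exists s, (s^-1 *: (c - v)); rewrite scaler_posK // subrKC; split; [by rewrite s0| |exact: tc].
have -> : s^-1 *: (c - v) - p = s^-1 *: ((c - v) *m oproj P).
  rewrite [c - v in LHS](proj_split P) mulmxBl cP [_ + s *: p]addrC addrK scalerDr.
  by rewrite scaler_posVK // addrC addKr.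
rewrite normrZ gtr0_norm ?invr_gt0 // mulrC ltr_pdivrMr //.
rewrite -(ltr_pM2l M0); apply: le_lt_trans cQ _; rewrite sp mulrA mulrC.
by rewrite ltr_pM2r.
Qed.

Lemma definable_closure : definable D Y.
Proof.
have -> : Y = [set x | forall h : R, 0 < h -> exists y, X y /\ `|y - x| < h].
  apply/seteqP; split=> x.
    by move=> /closure_norm cl h /cl[y Xy yx]; exists y.
  by move=> cl; apply/closure_norm => h /cl[y [Xy yx]]; exists y.
apply: defp_set; apply: defp_all; apply: defp_imp.
  exact: defp_lt (deff_cst _ _) (deff_var _ _).
apply: defp_exv; apply: defpI; first by apply: defp_mem => //; exact: (@defv_var _ _ n 0).
apply: defp_norm_lt; last exact: deff_var.
apply: defvB; first exact: (@defv_var _ _ n 0).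
have := @defv_ren _ D n (fun i => n + i)%N _ (@defv_var _ D n 1).
by [].
Qed.

(** A point [w] of the tangent cone close to [v], in the direction [u], lies at a
    distance from the plane through [v] comparable to that from [v]. Its sheet,
    of much smaller slope, meets the fibre of the projection through [v] at a
    point which is still off that plane. *)
Lemma fibre_not_isolated u (i : 'I_n) : tvec [set w | tvec X 0 w] v u ->
  (u *m oproj P) ord0 i != 0 -> forall h, 0 < h ->
  exists c, [/\ tvec X 0 c, c *m orthoproj P = v *m orthoproj P, `|c - v| < h &
    c ord0 i != v ord0 i].
Proof.
move=> tu ui h h0; pose l := `|(u *m oproj P) ord0 i|.
have l0 : 0 < l by rewrite normr_gt0.
have B0 : 0 < proj_bound n :> R := proj_bound_gt0 n.
have B1 : 1 <= proj_bound n :> R := proj_bound_ge1 n.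
pose K := `|u| + 1; have K0 : 0 < K by rewrite ltr_wpDl.
pose M := 1 + 4 * (proj_bound n * K) / l.
have M1 : 1 <= M by rewrite lerDl divr_ge0 ?mulr_ge0 // ltW.
have M0 : 0 < M by exact: lt_le_trans ltr01 M1.
have Ml : 4 * (proj_bound n * K) <= M * l.
  by rewrite /M [leRHS]mulrDl mul1r divfK ?gt_eqF // lerDr ltW.
have [r r0 rP] := cone_sheet M1.
(* The bounds on [g] ensure that [u'] and [u] have comparable components
   orthogonal to [P], that the sheet through [w] reaches the fibre, and that it
   does so within distance [h] of [v]. *)
pose g := Num.min (Num.min 1 (l / (4 * proj_bound n)))
  (Num.min (r / (16 * (proj_bound n * K))) (h / ((4 * proj_bound n + 1) * K))).
have B4 : 0 < 4 * proj_bound n + 1 :> R by apply: addr_gt0 => //; apply: mulr_gt0.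
have g0 : 0 < g by rewrite !lt_min ltr01 !divr_gt0 ?mulr_gt0.
have [t [u' [/andP[t0 tg] ug Cw]]] := tu g g0.
move: tg ug; rewrite !lt_min => /andP[_ /andP[tr th]] /andP[/andP[u1 ul] _].
have uK : `|u'| <= K by have := ler_normD (u' - u) u; rewrite subrK /K; lra.
move: tr th ul; rewrite !ltr_pdivlMr ?mulr_gt0 // => tr th ul.
pose w := v + t *: u'; have wv : w - v = t *: u' by rewrite /w addrAC subrr add0r.
have nwv : `|w - v| <= t * K by rewrite wv normrZ gtr0_norm // ler_pM2l.
have BK : t * K <= t * (proj_bound n * K) by rewrite ler_pM2l // ler_peMl // ltW.
have aw : `|v *m orthoproj P - w *m orthoproj P| <= t * (proj_bound n * K).
  rewrite -mulmxBl; apply: le_trans (orthoproj_le _ _) _; rewrite distrC mulrCA.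
  by rewrite ler_pM2l.
have [|||c [tc cP cw cQ]] := rP w (v *m orthoproj P) Cw.
- lra.
- exact: orthoproj_mem.
- lra.
exists c; split=> //.
  have := ler_normD (c - w) (w - v); rewrite addrA subrK.
  have : (4 * proj_bound n + 1) * (t * K) < h by rewrite mulrCA.
  by rewrite mulrDl mul1r; lra.
have cv : c - v = (c - w) *m oproj P + t *: (u' *m oproj P).
  rewrite scalemxAl -wv -mulmxDl addrA subrK {1}(proj_split P (c - v)).
  by rewrite mulmxBl cP subrr add0r.
have e1 : `|((c - w) *m oproj P) ord0 i| <= `|(c - w) *m oproj P| by exact: mx_entry_le.
have e2 : `|((u' - u) *m oproj P) ord0 i| <= proj_bound n * `|u' - u|.
  exact: le_trans (mx_entry_le _ _ _) (oproj_le _ _).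
rewrite -subr_eq0; apply/eqP => ci.
have ci0 : ((c - w) *m oproj P) ord0 i + t * (u' *m oproj P) ord0 i = 0.
  by rewrite -ci; have := congr1 (fun z : 'rV[R]_n => z ord0 i) cv; rewrite !mxE => ->.
have e3 : t * `|(u' *m oproj P) ord0 i| <= `|(c - w) *m oproj P|.
  by rewrite -{1}(gtr0_norm t0) -normrM -(addr0_eq ci0) normrN.
have e4 : l <= `|(u' *m oproj P) ord0 i| + proj_bound n * `|u' - u|.
  have -> : l = `|(u' *m oproj P) ord0 i - ((u' - u) *m oproj P) ord0 i|.
    by congr `|_|; rewrite mulmxBl [X in _ - X]mxE [X in _ - (_ + X)]mxE; ring.
  by apply: le_trans (ler_normB _ _) _; rewrite lerD2l.
have e5 : M * (t * `|(u' *m oproj P) ord0 i|) <= t * (proj_bound n * K).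
  by apply: le_trans aw; apply: le_trans cQ; rewrite ler_pM2l.
have e6 : t * (4 * (M * `|(u' *m oproj P) ord0 i|)) <= t * (M * l) .
  have := ler_wpM2l (ltW t0) Ml; move: e5; rewrite (mulrCA M); lra.
have e7 : 4 * `|(u' *m oproj P) ord0 i| <= l.
  by move: e6; rewrite ler_pM2l // mulrCA ler_pM2l.
lra.
Qed.

(** With a direction [u] outside [P], the fibre of the tangent cone above the
    projection of [v] accumulates at [v]. It is the limit, as [t] tends to 0, of
    the fibres of the dilations of [Y] by the inverse of [t], which are finite
    because they are compact and discrete. Read through one coordinate, this
    contradicts [definable_limit_thin]. *)
Lemma double_cone_in_plane u : tvec [set w | tvec X 0 w] v u -> u \in P.
Proof.
move=> tu; apply: contrapT => uP.
have [i ui] : exists i, (u *m oproj P) ord0 i != 0.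
  apply: contrapT => /forallNP ui; apply: uP; apply/oproj_mem0/rowP => i.
  by rewrite [RHS]mxE; apply/eqP; apply: contrapT => /negP; exact: ui.
have B0 : 0 < proj_bound n :> R := proj_bound_gt0 n.
have [r r0 rP] := rescaled_sheet (lexx 1).
have [h h0 hP] := fibre_isolated.
pose q := Num.min (r / 2) (h / 2).
have q0 : 0 < q by rewrite lt_min !divr_gt0.
have [qr qh] : q <= r / 2 /\ q <= h / 2 by rewrite /q; split; rewrite ge_min lexx ?orbT.
pose T (t s : R) := exists x, [/\ Y (t *: x), `|x - v| <= q, x *m orthoproj P = v *m orthoproj P &
  x ord0 i = s].
have dT : defp D (fun e => T (e 0%N) (e 1%N)).
  apply: (@defp_ext _ D (fun e => exists x, Y (e 0%N *: x) /\ `|x - v| <= q /\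
    x *m orthoproj P = v *m orthoproj P /\ x ord0 i = e 1%N)).
    by move=> e; split=> [[x [? [? [? ?]]]]|[x [? ? ? ?]]]; exists x.
  have dx : defv D (fun e => row_of n e) by exact: (@defv_var _ D n 0).
  apply: defp_exv; apply: defpI.
    apply: defp_mem; first exact: definable_closure.
    by apply: defvZ dx; exact: deff_var.
  apply: defpI.
    by apply: defp_norm_le (deff_cst _ _); apply: defvB dx (defv_cst _ _).
  apply: defpI; first by apply: defp_eqvec (defv_mulmx _ dx) (defv_cst _ _).
  by apply: defp_eq; [exact: dx|exact: deff_var].
pose K (s : R) := forall g, 0 < g -> exists t s', [/\ 0 < t < g, `|s' - s| < g & T t s'].
have dK : defp D (fun e => K (e 0%N)).
  apply: defp_all; apply: defp_imp; first exact: defp_lt (deff_cst _ _) (deff_var _ _).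
  apply: (@defp_ext _ D (fun e => exists t s', (0 < t /\ t < e 0%N) /\
      (s' - e 1%N < e 0%N /\ - e 0%N < s' - e 1%N) /\ T t s')).
    move=> e; split=> [[t [s' [[t0 tg] [[s1 s2] Tts]]]]|[t [s' [/andP[t0 tg] sg Tts]]]];
      exists t, s'.
      by split=> //; [rewrite t0|rewrite ltr_norml s2].
    by split=> //; split=> //; move: sg; rewrite ltr_norml => /andP[].
  apply: defp_ex; apply: defp_ex; apply: defpI.
    by apply: defpI; apply: defp_lt; try exact: deff_var; exact: deff_cst.
  apply: defpI; last first.
    exact: (defp_ren (fun i => if i is 0 then 1 else 0)%N dT).
  by apply: defpI; apply: defp_lt; rewrite /=;
    do ?[exact: deff_var | apply: deffN | apply: deffB].
have thin t a b : 0 < t < Num.min r h -> a < b -> exists2 s, a < s < b & ~ T t s.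
  move=> /andP[t0]; rewrite lt_min => /andP[tr th] ab; apply: contrapT => all_s.
  pose s k : R := a + (b - a) / k.+2%:R.
  have sab k : a < s k < b.
    have k0 : 0 < k.+2%:R^-1 :> R by rewrite invr_gt0 ltr0n.
    have k1 : k.+2%:R^-1 < 1 :> R by rewrite invf_lt1 ?ltr0n // ltr1n.
    move: k0 k1; rewrite /s; move: (k.+2%:R^-1) => z z0 z1.
    have ba : 0 < b - a by rewrite subr_gt0.
    by rewrite ltrDl mulr_gt0 //= -ltrBrDl gtr_pMr.
  have Ts k : T t (s k).
    by apply: contrapT => nT; apply: all_s; exists (s k); [exact: sab|exact: nT].
  (* Infinitely many points of the fibre would accumulate inside it. *)
  have [x xP] := choice Ts.
  have [k|l lP] := @bounded_cluster R n x (`|v| + q).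
    by have [_ xv _ _] := xP k; have := ler_normD (x k - v) v; rewrite subrK; lra.
  have clo (A : set 'rV[R]_n) : closed A -> (forall k, A (x k)) -> A l.
    move=> cA Ax; apply: cA; apply/closure_norm => g g0.
    by have [k _ kl] := lP g 0%N g0; exists (x k).
  have Yl : Y (t *: l) by apply: (clo _ (@closed_dilate t)) => k; have [] := xP k.
  have lv : `|l - v| <= q.
    apply/ler_addgt0Pr => g g0; have [k _ kl] := lP g 0%N g0.
    have [_ xv _ _] := xP k; have := ler_normD (l - x k) (x k - v).
    by rewrite addrA subrK; rewrite distrC in kl; lra.
  have lE : l *m orthoproj P = v *m orthoproj P.
    apply/subr0_eq/(le0_norm_eq0 B0) => g /andP[g0 _]; have [k _ kl] := lP g 0%N g0.
    have [_ _ <- _] := xP k; rewrite -mulmxBl; apply: le_trans (orthoproj_le _ _) _.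
    by rewrite ler_pM2l // distrC ltW.
  have [||g g0 gP] := hP t l _ _ Yl; first by rewrite t0.
    by apply: le_lt_trans lv _; lra.
  have xl k : `|x k - l| < g -> x k = l.
    by have [Yx _ xE _] := xP k; move=> kl; apply: gP; rewrite ?xE.
  have [k1 _ /xl x1] := lP g 0%N g0; have [k2 k12 /xl x2] := lP g k1.+1 g0.
  have [_ _ _ s1] := xP k1; have [_ _ _ s2] := xP k2.
  have : s k1 = s k2 by rewrite -s1 -s2 x1 x2.
  move=> /addrI/(mulfI _); rewrite subr_eq0 gt_eqF // => /(_ isT) /invr_inj /eqP.
  by rewrite eqr_nat !eqSS => /eqP k12E; move: k12; rewrite k12E ltnn.
have Kc c : tvec X 0 c -> c *m orthoproj P = v *m orthoproj P -> `|c - v| < q / 2 -> K (c ord0 i).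
  move=> tc cE cv g g0.
  have B4 : 0 < 4 * proj_bound n + 1 :> R by apply: addr_gt0 => //; apply: mulr_gt0.
  pose e := Num.min (Num.min g r) (Num.min (r / 16) (Num.min g (q / 2))) / (4 * proj_bound n + 1).
  have m0 : 0 < Num.min (Num.min g r) (Num.min (r / 16) (Num.min g (q / 2))).
    by rewrite !lt_min g0 r0 !divr_gt0.
  have e0 : 0 < e by rewrite divr_gt0.
  have eE : e * (4 * proj_bound n + 1) =
      Num.min (Num.min g r) (Num.min (r / 16) (Num.min g (q / 2))).
    by rewrite divfK // gt_eqF.
  have [t [x [/andP[t0 te] xc]]] := tc e e0; rewrite add0r => Xtx.
  have : e * (4 * proj_bound n + 1) <=
      Num.min (Num.min g r) (Num.min (r / 16) (Num.min g (q / 2))) by rewrite eE.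
  rewrite !le_min => /andP[/andP[eg er] /andP[er16 /andP[_ eq2]]].
  have eB : 0 < e * proj_bound n by rewrite mulr_gt0.
  have xa : `|v *m orthoproj P - x *m orthoproj P| <= e * proj_bound n.
    rewrite -cE -mulmxBl; apply: le_trans (orthoproj_le _ _) _.
    by rewrite distrC mulrC ler_pM2r // ltW.
  rewrite mulrDr mulr1 mulrCA in eg er er16 eq2.
  have [||||x' [Yx' x'E x'x _]] := rP t x (v *m orthoproj P) _ (XY Xtx).
  - by rewrite t0 /=; lra.
  - by have := ler_normD (x - c) (c - v); rewrite addrA subrK; lra.
  - exact: orthoproj_mem.
  - lra.
  have x'c : `|x' - c| < 4 * (e * proj_bound n) + e.
    by have := ler_normD (x' - x) (x - c); rewrite addrA subrK; lra.
  exists t, (x' ord0 i); split; first by rewrite t0 /=; lra.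
    have := mx_entry_le (x' - c) ord0 i; rewrite [(x' - c) _ _]mxE [(- c) _ _]mxE; lra.
  exists x'; split=> //.
  by have := ler_normD (x' - c) (c - v); rewrite addrA subrK; lra.
have [g g0|a [b [ab abK]]] := definable_accumulation (S := K) (p := v ord0 i) dK.
  have [|c [tc cE cv ci]] := fibre_not_isolated tu ui (h := Num.min g (q / 2)).
    by rewrite lt_min g0 divr_gt0.
  move: cv; rewrite lt_min => /andP[cg cq]; exists (c ord0 i); split=> //.
    have := mx_entry_le (c - v) ord0 i; rewrite [(c - v) _ _]mxE [(- v) _ _]mxE.
    by move=> /le_lt_trans; apply.
  exact: Kc.
have rh0 : 0 < Num.min r h by rewrite lt_min r0.
have [s sab nK] := definable_limit_thin dT rh0 thin ab.
by apply: nK; exact: abK.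
Qed.

End ConeRay.

Unset Implicit Arguments.
Set Strict Implicit.

Theorem theorem1p3 (R : realType) (D : ominimal_structure R) (n d : nat)
    (X : set 'rV[R]_n) (hX : definable D X) (hd : (0 < d)%N)
    (hpure : pure_dim_at X 0 d) (v : 'rV[R]_n)
    (hv : (tangent_cone X 0 `\` tangent_cone (sing (closure X)) 0) v)
    (hv0 : v <> 0)
    (hnotplane : ~ exists P : {vspace 'rV[R]_n},
        \dim P = d /\ tangent_cone (tangent_cone X 0) v = [set` P]) :
  exceptional d X v.
Proof.
have [/tangent_coneP vC vS] := hv.
have {}vS : ~ tvec (sing (closure X)) 0 v by move/tangent_coneP.
apply: contrapT => nexc; apply: hnotplane.
have [P NP] := nash_fiber_nonempty hX hd hpure hv0 vC vS.
have PN P' : nash_fiber d X v P' -> P' = P.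
  move=> NP'; apply: contrapT => PP'; apply: nexc; split=> //.
    move=> _ [r r0 <-]; split; first exact/tangent_coneP/tvecZ.
    move=> /tangent_coneP tr; apply: vS.
    have /(tvecZ (c := r^-1)) := tr; rewrite scaler_posVK //; apply.
    by rewrite invr_gt0.
  exact: card_ge_two NP' NP PP'.
exists P; split; first by case: NP.
have CE : tangent_cone X 0 = [set w | tvec X 0 w].
  by apply/seteqP; split=> w /tangent_coneP.
rewrite CE; apply/seteqP; split=> w.
  by move=> /tangent_coneP/(double_cone_in_plane hX hd hpure hv0 vS PN).
move=> /(plane_in_double_cone hX hd hpure hv0 vC vS PN) wC.
exact/tangent_coneP.
Qed.
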